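(* Let $n,r$ be integers with $2<r<n$. Let $\mathrm{ESP}_r$ be the $r$-th elementary symmetric polynomial in $n$ variables over $\mathbb{C}$, let $\Omega_r=\{\mathrm{ESP}_r\circ g : g\in\mathrm{GL}_n(\mathbb{C})\}$ be its orbit in the space $V_r=\mathbb{C}[X_1,\ldots,X_n]_r$ of homogeneous polynomials of degree $r$, and let $\overline{\Omega}_r\subseteq V_r$ be the Zariski closure of $\Omega_r$. Let $S_r\subseteq\mathbb{Z}^n$ be the set of dominant weights $\lambda$ such that the irreducible $\mathrm{GL}_n$-module $\mathbb{V}(\lambda)$ occurs in the coordinate ring $\mathbb{C}[\overline{\Omega}_r]$. Then the subgroup of $\mathbb{Z}^n$ generated by $S_r$ is equal to $\{\lambda\in\mathbb{Z}^n : \lambda_1+\cdots+\lambda_n\in r\mathbb{Z}\}$.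
   Context: The $r$-th elementary symmetric polynomial is $\mathrm{ESP}_r(X_1,\ldots,X_n)=\sum_{I\subseteq\{1,\ldots,n\},\,|I|=r}\prod_{i\in I}X_i$. The group $\mathrm{GL}_n=\mathrm{GL}_n(\mathbb{C})$ acts on $V_r$ from the right by $P\mapsto P\circ g$ (precomposition with the linear map $g$ of $\mathbb{C}^n$); this preserves $\overline{\Omega}_r$ and induces a linear action of $\mathrm{GL}_n$ on the coordinate ring $\mathbb{C}[\overline{\Omega}_r]$ by $(g\cdot f)(P)=f(P\circ g)$, under which $\mathbb{C}[\overline{\Omega}_r]$ decomposes into irreducible rational $\mathrm{GL}_n$-modules. The irreducible rational representations of $\mathrm{GL}_n$ are classified by the dominant weights $\Lambda=\{\lambda\in\mathbb{Z}^n : \lambda_1\ge\cdots\ge\lambda_n\}$; $\mathbb{V}(\lambda)$ denotes the irreducible module of highest weight $\lambda$, and $S_r=\{\lambda\in\Lambda : \mathbb{V}(\lambda)\subseteq\mathbb{C}[\overline{\Omega}_r]\}$. *)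

(* Defs.v *)
From HB Require Import structures.
From mathcomp Require Import all_boot all_order all_algebra.
From mathcomp Require Import mpoly complex.
From mathcomp Require Import boolp classical_sets functions reals.

Set Implicit Arguments.
Unset Strict Implicit.
Unset Printing Implicit Defensive.

Import Order.TTheory GRing.Theory Num.Theory.

Local Open Scope classical_set_scope.
Local Open Scope ring_scope.

Section GeneralLinearGroup.
Variables (K : fieldType) (n : nat).

Record GL := MkGL { GL_mx :> 'M[K]_n ; GL_unit : GL_mx \in unitmx }.

HB.instance Definition _ := [isSub for GL_mx].
HB.instance Definition _ := [Choice of GL by <:].

Definition GL_one : GL := MkGL (unitmx1 K n).

Fact GL_mul_subproof (g h : GL) : GL_mx g *m GL_mx h \in unitmx.
Proof. by rewrite unitmx_mul !GL_unit. Qed.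
Definition GL_mul (g h : GL) : GL := MkGL (GL_mul_subproof g h).

Fact GL_inv_subproof (g : GL) : invmx g \in unitmx.
Proof. by rewrite unitmx_inv GL_unit. Qed.
Definition GL_inv (g : GL) : GL := MkGL (GL_inv_subproof g).

Fact GL_mulA : associative GL_mul.
Proof. by move=> g h k; apply: val_inj; rewrite /= mulmxA. Qed.
Fact GL_mul1 : left_id GL_one GL_mul.
Proof. by move=> g; apply: val_inj; rewrite /= mul1mx. Qed.
Fact GL_mulr1 : right_id GL_one GL_mul.
Proof. by move=> g; apply: val_inj; rewrite /= mulmx1. Qed.
Fact GL_mulV : left_inverse GL_one GL_inv GL_mul.
Proof. by move=> g; apply: val_inj; rewrite /= mulVmx ?GL_unit. Qed.
Fact GL_mulrV : right_inverse GL_one GL_inv GL_mul.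
Proof. by move=> g; apply: val_inj; rewrite /= mulmxV ?GL_unit. Qed.

HB.instance Definition _ :=
  isGroup.Build GL GL_mulA GL_mul1 GL_mulr1 GL_mulV GL_mulrV.

End GeneralLinearGroup.

Section PolynomialFunctions.
Variables (K : fieldType) (V : lmodType K).

(* A polynomial in finitely many linear forms: for finite-dimensional [V] these
   are the polynomials in the coordinates with respect to any basis. *)
Definition polynomial_function (f : V -> K) : Prop :=
  exists (k : nat) (l : 'I_k -> {scalar V}) (F : {mpoly K[k]}),
    forall v, f v = F.@[fun i => l i v].

Lemma polynomial_function_comp2 (f g : V -> K)
    (m : forall k, {mpoly K[k]} -> {mpoly K[k]} -> {mpoly K[k]})
    (op : K -> K -> K) :
    (forall k (G H : {mpoly K[k]}) x, (m k G H).@[x] = op G.@[x] H.@[x]) ->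
  polynomial_function f -> polynomial_function g ->
  polynomial_function (fun v => op (f v) (g v)).
Proof.
move=> mE [k1 [l1 [F1 E1]]] [k2 [l2 [F2 E2]]].
exists (k1 + k2)%N.
exists (fun i : 'I_(k1 + k2) =>
          match fintype.split i with inl j => l1 j | inr j => l2 j end).
exists (m _ (F1 \mPo [tuple 'X_(lshift k2 i) | i < k1])
            (F2 \mPo [tuple 'X_(rshift k1 i) | i < k2])).
move=> v; rewrite mE !comp_mpoly_meval E1 E2; congr op; apply: meval_eq => i.
  by rewrite tnth_mktuple mevalXU (unsplitK (inl i)).
by rewrite tnth_mktuple mevalXU (unsplitK (inr i)).
Qed.

Lemma polynomial_functionD f g : polynomial_function f ->
  polynomial_function g -> polynomial_function (f \+ g).
Proof.
by apply: (polynomial_function_comp2 (m := fun k => +%R)) => *; exact: mevalD.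
Qed.

Lemma polynomial_functionM f g : polynomial_function f ->
  polynomial_function g -> polynomial_function (f \* g).
Proof.
by apply: (polynomial_function_comp2 (m := fun k => *%R)) => *; exact: mevalM.
Qed.

Lemma polynomial_function_cst c : polynomial_function (fun=> c).
Proof.
by exists 0%N, (fun=> \0 : {scalar V}), c%:MP => v; rewrite mevalC.
Qed.

End PolynomialFunctions.

Lemma polynomial_function_linear (K : fieldType) (U V : lmodType K)
    (h : {linear U -> V}) (f : V -> K) :
  polynomial_function f -> polynomial_function (f \o h).
Proof.
move=> [k [l [F E]]].
by exists k, (fun i => (l i \o h : {scalar U})), F => v /=; rewrite E.
Qed.

Section ZariskiClosure.
Variables (K : fieldType) (V : lmodType K).

Definition zariski_closure (X : set V) : set V :=
  [set v | forall f : V -> K, polynomial_function f ->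
             (forall x, X x -> f x = 0) -> f v = 0].

Definition regular_function (X : set V) : {pred X -> K^o} :=
  fun f => `[< exists2 F : V -> K, polynomial_function F &
                 forall x : X, f x = F (val x) >].
Arguments regular_function : clear implicits.

Lemma regular_functionP (X : set V) (f : X -> K^o) :
  reflect (exists2 F : V -> K, polynomial_function F &
             forall x : X, f x = F (val x))
          (f \in regular_function X).
Proof. exact: asboolP. Qed.

Variable X : set V.

Fact regular_function_subring : subring_closed (regular_function X).
Proof.
split=> [|f g /regular_functionP[F pF fE] /regular_functionP[G pG gE]
         |f g /regular_functionP[F pF fE] /regular_functionP[G pG gE]];
  apply/regular_functionP.
- by exists (fun=> 1) => //; exact: polynomial_function_cst.
- exists (F \+ ((fun=> -1) \* G)) => [|x].
    apply: polynomial_functionD => //; apply: polynomial_functionM => //.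
    exact: polynomial_function_cst.
  by rewrite /= mulN1r -fE -gE.
- by exists (F \* G) => [|x]; [exact: polynomial_functionM|rewrite /= -fE -gE].
Qed.

Fact regular_function_submod : submod_closed (regular_function X).
Proof.
split=> [|c f g /regular_functionP[F pF fE] /regular_functionP[G pG gE]];
  apply/regular_functionP.
  by exists (fun=> 0) => //; exact: polynomial_function_cst.
exists (((fun=> c) \* F) \+ G) => [|x]; last by rewrite /= -fE -gE.
apply: polynomial_functionD => //; apply: polynomial_functionM => //.
exact: polynomial_function_cst.
Qed.

HB.instance Definition _ :=
  GRing.isSubringClosed.Build _ (regular_function X) regular_function_subring.
HB.instance Definition _ :=
  GRing.isSubmodClosed.Build _ _ (regular_function X) regular_function_submod.

(* K[V] / I(X), realized as the restrictions to [X] of the polynomial functions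
   on [V]; for closed [X] this is the coordinate ring of the variety [X]. *)
Record coordinate_ring := RegularFunction {
  regular_fun :> X -> K^o ; _ : regular_fun \in regular_function X }.

HB.instance Definition _ := [isSub for regular_fun].
HB.instance Definition _ := [Choice of coordinate_ring by <:].
HB.instance Definition _ :=
  GRing.SubChoice_isSubComPzRing.Build _ _ coordinate_ring
    regular_function_subring.
HB.instance Definition _ :=
  [SubZmodule_isSubLmodule of coordinate_ring by <:].

Lemma coordinate_ringP (f : coordinate_ring) :
  exists2 F : V -> K, polynomial_function F & forall x : X, f x = F (val x).
Proof. exact/regular_functionP/(valP f). Qed.

End ZariskiClosure.

Arguments regular_function {K V} X f.

Section Representations.
Variables (K : fieldType) (n : nat).

(* The coordinate ring of GL_n is K[g_ij, det^-1]. *)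
Definition regular_on_GL (f : GL K n -> K) : Prop :=
  exists (k : nat) (F : 'M[K]_n -> K), polynomial_function F /\
    forall g : GL K n, f g = F g / \det g ^+ k.

Variable V : vectType K.
Implicit Type rho : GL K n -> 'End(V).

(* The last clause says that every matrix coefficient is a regular function. *)
Definition rational_representation rho : Prop :=
  [/\ rho 1%g = \1%VF,
      forall g h, rho (g * h)%g = (rho g \o rho h)%VF
    & forall (l : {scalar V}) v, regular_on_GL (fun g => l (rho g v))].

Definition irreducible_representation rho : Prop :=
  fullv != 0%VS :> {vspace V} /\
  forall U : {vspace V}, (forall g, (rho g @: U <= U)%VS) ->
    U = 0%VS \/ U = fullv.

Definition upper_unitriangular (u : 'M[K]_n) : Prop :=
  forall i j : 'I_n, (j <= i)%N -> u i j = (i == j)%:R.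

(* Highest weights are taken with respect to the Borel subgroup of
   upper triangular matrices and the torus of diagonal matrices. *)
Definition highest_weight_vector rho (lambda : 'rV[int]_n) (v : V) : Prop :=
  [/\ v != 0,
      forall u : GL K n, upper_unitriangular u -> rho u v = v
    & forall (t : GL K n) (d : 'rV[K]_n), t = diag_mx d :> 'M_n ->
        rho t v = (\prod_i d 0 i ^ lambda 0 i) *: v].

Definition irreducible_of_highest_weight (lambda : 'rV[int]_n) rho : Prop :=
  [/\ rational_representation rho, irreducible_representation rho
    & exists v, highest_weight_vector rho lambda v].

End Representations.

Definition dominant (n : nat) (lambda : 'rV[int]_n) : Prop :=
  forall i j : 'I_n, (i <= j)%N -> lambda 0 j <= lambda 0 i.

Section OrbitClosure.
Variables (K : fieldType) (n r : nat).

(* The linear forms giving the coordinates of [g x], see [precomp_eval]. *)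
Definition linear_subst (g : 'M[K]_n) : n.-tuple {mpoly K[n]} :=
  [tuple \sum_j g i j *: 'X_j | i < n].

Fact precomp_subproof (g : GL K n) (P : dhomog n K r) :
  mpoly_of_dhomog P \mPo linear_subst g \is r.-homog.
Proof.
rewrite comp_mpolyEX big_seq rpred_sum // => m mP; apply: rpredZ.
have <- : mdeg m = r by exact: (dhomog_mf (dhomog_is_dhomog P) mP).
rewrite comp_mpolyX mdegE.
elim/big_rec2: _ => [|i d p _ hp]; first exact: dhomog1.
apply: dhomogM => //; rewrite -[X in X.-homog]mul1n; apply: dhomogMn.
rewrite tnth_mktuple rpred_sum // => j _; apply: rpredZ.
by rewrite dhomogX /= mdeg1.
Qed.

Definition precomp (g : GL K n) (P : dhomog n K r) : dhomog n K r :=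
  DHomog (precomp_subproof g P).

Lemma precomp_eval (g : GL K n) (P : dhomog n K r) (x : 'cV[K]_n) :
  (precomp g P : {mpoly K[n]}).@[fun i => x i 0]
    = (P : {mpoly K[n]}).@[fun i => (GL_mx g *m x) i 0].
Proof.
rewrite comp_mpoly_meval; apply: meval_eq => i.
rewrite tnth_mktuple mxE raddf_sum /=; apply: eq_bigr => j _.
by rewrite mevalZ mevalXU.
Qed.

Lemma linear_substM (g h : 'M[K]_n) (P : {mpoly K[n]}) :
  (P \mPo linear_subst g) \mPo linear_subst h = P \mPo linear_subst (g *m h).
Proof.
have substE i : tnth (linear_subst g) i \mPo linear_subst h
    = tnth (linear_subst (g *m h)) i.
  rewrite !tnth_mktuple raddf_sum /=.
  under eq_bigr => j _ do
    rewrite comp_mpolyZ comp_mpolyXU -tnth_nth tnth_mktuple scaler_sumr.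
  rewrite exchange_big /=; apply: eq_bigr => k _.
  by rewrite mxE scaler_suml; apply: eq_bigr => j _; rewrite scalerA.
rewrite (comp_mpolyEX P (linear_subst g)) (comp_mpolyEX P) raddf_sum /=.
apply: eq_bigr => m _; rewrite !comp_mpolyZ; congr (_ *: _).
rewrite !comp_mpolyX rmorph_prod /=; apply: eq_bigr => i _.
by rewrite rmorphXn /= substE.
Qed.

Lemma precompM (g h : GL K n) (P : dhomog n K r) :
  precomp (g * h)%g P = precomp h (precomp g P).
Proof. by apply: val_inj; rewrite /= linear_substM. Qed.

Fact precomp_is_linear (g : GL K n) : linear (precomp g).
Proof. by move=> c P Q; apply: val_inj; rewrite /= linearP. Qed.
HB.instance Definition _ (g : GL K n) :=
  GRing.isLinear.Build K (dhomog n K r) (dhomog n K r) _ (precomp g)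
    (precomp_is_linear g).

Definition ESP : dhomog n K r := DHomog (dhomog_mesym n K r).

Definition ESP_orbit : set (dhomog n K r) :=
  [set precomp g ESP | g in [set: GL K n]].

Definition ESP_orbit_closure : set (dhomog n K r) := zariski_closure ESP_orbit.

Lemma precomp_orbit_closure (g : GL K n) (P : dhomog n K r) :
  ESP_orbit_closure P -> ESP_orbit_closure (precomp g P).
Proof.
move=> clP f pf f0; apply: (clP (f \o precomp g)).
  exact: polynomial_function_linear.
by move=> _ [h _ <-]; apply: f0; exists (h * g)%g; rewrite ?precompM.
Qed.

Definition orbit_closure_precomp (g : GL K n) (P : ESP_orbit_closure) :
    ESP_orbit_closure :=
  SigSub (mem_set (precomp_orbit_closure g (set_valP P))).

Fact coordinate_ring_act_subproof
    (g : GL K n) (f : coordinate_ring ESP_orbit_closure) :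
  (fun P => f (orbit_closure_precomp g P))
    \in regular_function ESP_orbit_closure.
Proof.
have [F pF fE] := coordinate_ringP f.
apply/regular_functionP; exists (F \o precomp g) => [|P].
  exact: polynomial_function_linear.
by rewrite fE.
Qed.

(* (g . f)(P) = f (P \o g) *)
Definition coordinate_ring_act
    (g : GL K n) (f : coordinate_ring ESP_orbit_closure) :
    coordinate_ring ESP_orbit_closure :=
  RegularFunction (coordinate_ring_act_subproof g f).

(* The irreducible module V(lambda) is determined up to isomorphism by its
   highest weight, so it is quantified over instead of being constructed. *)
Definition occurs (lambda : 'rV[int]_n) : Prop :=
  exists (V : vectType K) (rho : GL K n -> 'End(V))
    (phi : {linear V -> coordinate_ring ESP_orbit_closure}),
    [/\ irreducible_of_highest_weight lambda rho, injective phi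
      & forall g v, phi (rho g v) = coordinate_ring_act g (phi v)].

Definition ESP_weights : set 'rV[int]_n :=
  [set lambda | dominant lambda /\ occurs lambda].

End OrbitClosure.

Arguments ESP_weights : clear implicits.

Definition subgroup_closed (Z : zmodType) (H : set Z) : Prop :=
  H 0 /\ forall x y, H x -> H y -> H (x - y).

Definition generated_subgroup (Z : zmodType) (S : set Z) : set Z :=
  smallest (@subgroup_closed Z) S.

(* Main.v *)
(* Scalars that are r-th roots of unity act trivially on V_r, so every weight has
   degree divisible by r.

   Conversely, a polynomial function F on V_r that transforms under upper
   triangular matrices by the character lambda and does not vanish on the orbit
   makes V(lambda) occur. Functions on V_r are linear combinations of products of
   polarized coefficients, so they are images of tensors, and a space of tensors
   carries a Hermitian form for which the adjoint of g is its conjugate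
   transpose. Stable subspaces therefore have stable complements; the submodule
   generated by a highest weight vector is irreducible because g |-> <g z, v> is
   determined by its values on the dense set of products of a lower
   unitriangular and an upper triangular matrix.

   Let B and C be the second and third derivatives of P at e_1. The Gram
   determinants D_k of B on <e_1, ..., e_k> have weight
   k(r-2)e_1 + 2(e_1 + ... + e_k). If w_k is the last vector of the Gram-Schmidt
   process applied to e_1, ..., e_k, normalized by D_k, then D_k C(w_k, w_k, w_k)
   has weight 4 wt(D_k) - (2r-3)e_1 - 3e_k. Together these weights generate r e_1
   and all e_k - e_1. They do not vanish on the orbit: at the point (1, ..., 1)
   the form B is proportional to (sum x)^2 - sum x^2, and C restricted to the
   hyperplane sum x = 0 is proportional to sum x^3, so one can take the frame
   given by the Helmert matrix, up to the order of its columns. *)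

Require Import Defs.
From HB Require Import structures.
From mathcomp Require Import all_boot all_order all_algebra.
From mathcomp Require Import perm cyclic separable cyclotomic ring zify.
From mathcomp Require Import mpoly complex.
From mathcomp Require Import boolp classical_sets functions reals.

Set Implicit Arguments.
Unset Strict Implicit.
Unset Printing Implicit Defensive.

Import Order.TTheory GRing.Theory Num.Theory.

Local Open Scope classical_set_scope.
Local Open Scope ring_scope.

(** * Zariski density of the big cell *)

Section PolynomialOnLines.
Variable C : numFieldType.

(** Weaker than [polynomial_function], this property restricts directly to the affine slices of
    block matrices used in the induction below. *)
Definition polynomial_on_lines (V : lmodType C) (f : V -> C) : Prop :=
  forall x y : V, exists q : {poly C}, forall s, f (x + s *: y) = q.[s].

Lemma polynomial_function_on_lines (V : lmodType C) (f : V -> C) :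
  polynomial_function f -> polynomial_on_lines f.
Proof.
move=> [k [l [F E]]] x y.
exists (\sum_(m <- msupp F) F@_m *:
          \prod_i ((l i x)%:P + (l i y) *: 'X) ^+ m i) => s.
rewrite E mevalE horner_sum; apply: eq_bigr => m _.
rewrite hornerZ horner_prod; congr (_ * _); apply: eq_bigr => i _.
by rewrite horner_exp hornerD hornerC hornerZ hornerX linearD linearZ /= mulrC.
Qed.

(** The integers from 1 to [size q] are distinct nonzero roots, one too many for a nonzero
    polynomial. *)
Lemma poly_eq0_off0 (q : {poly C}) : (forall s, s != 0 -> q.[s] = 0) -> q = 0.
Proof.
move=> q0; apply/eqP/negPn/negP => qn0.
have /(max_poly_roots qn0): all (root q) [seq i.+1%:R | i <- iota 0 (size q)].
  by apply/allP => _ /mapP[i _ ->]; rewrite rootE q0 ?pnatr_eq0.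
rewrite size_map size_iota ltnn map_inj_uniq ?iota_uniq; first by move/(_ isT).
by move=> i j /eqP; rewrite eqr_nat eqSS => /eqP.
Qed.

Definition upper_triangular n (b : 'M[C]_n) : Prop :=
  forall i j : 'I_n, (j < i)%N -> b i j = 0.

(* The products [l *m b] fill the big cell of the Bruhat decomposition. *)
Lemma big_cell_dense n (f : 'M[C]_n -> C) : polynomial_on_lines f ->
  (forall l b, upper_unitriangular l^T -> upper_triangular b ->
     b \in unitmx -> f (l *m b) = 0) ->
  forall g, f g = 0.
Proof.
elim: n f => [|n IHn]; last rewrite -[n.+1]/(1 + n)%N; move=> f pf f0 g.
  have -> : g = 1%:M *m 1%:M by apply/matrixP => -[].
  by apply: f0 => [[]|[]|] //; rewrite unitmx1.
rewrite -[g]submxK.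
set a := ulsubmx g; set b := ursubmx g; set c := dlsubmx g.
move: (drsubmx g) => D.
(* For a nonzero corner [s], block elimination leaves the Schur complement of the corner, to which
   the induction hypothesis applies. *)
have fn0 s : s != 0 -> f (block_mx (s%:M : 'M_1) b c D) = 0.
  move=> s0; pose A := block_mx (s%:M : 'M_1) b c.
  rewrite -[D](subrKC (s^-1 *: (c *m b))).
  pose f' D' := f (A (s^-1 *: (c *m b) + D')).
  have : polynomial_on_lines f'.
    move=> x y.
    have [q qE] := pf (A (s^-1 *: (c *m b) + x)) (block_mx 0 0 0 y).
    exists q => u; rewrite -qE /f'; congr f.
    by rewrite scale_block_mx !scaler0 add_block_mx !addr0 addrA.
  move/IHn; apply => l' b' hl hb ub.
  have -> : f' (l' *m b') = f (block_mx 1%:M 0 (s^-1 *: c) l' *m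
                                block_mx (s%:M : 'M_1) b 0 b').
    rewrite /f' /A mulmx_block !mulmx0 !mul0mx !addr0 !mul1mx.
    by rewrite mul_mx_scalar scalerA divff // scale1r -scalemxAl.
  apply: f0.
  - rewrite tr_block_mx trmx1 trmx0 => i j.
    case: (fintype.split_ordP i) => i' ->;
      case: (fintype.split_ordP j) => j' ->.
    + by rewrite block_mxEul !mxE (inj_eq (@lshift_inj _ _)).
    + by rewrite /= !ord1.
    + by rewrite block_mxEdl !mxE eq_rlshift.
    + by rewrite /= block_mxEdr (inj_eq (@rshift_inj _ _)) leq_add2l => /hl.
  - move=> i j.
    case: (fintype.split_ordP i) => i' ->;
      case: (fintype.split_ordP j) => j' ->.
    + by rewrite /= !ord1.
    + by rewrite /= !ord1.
    + by rewrite block_mxEdl !mxE.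
    + by rewrite /= block_mxEdr ltn_add2l => /hb.
  - move: ub; rewrite !unitmxE det_ublock det_scalar1 !unitfE => ub.
    by rewrite mulf_neq0.
have -> : a = (a 0 0)%:M by rewrite -mx11_scalar.
(* A zero corner is reached by varying the corner alone: a polynomial vanishing away from 0 vanishes
   identically. *)
have [q qE] := pf (block_mx 0 b c D) (block_mx (1%:M : 'M_1) 0 0 0).
have lineE s : block_mx 0 b c D + s *: block_mx (1%:M : 'M_1) 0 0 0 =
               block_mx (s%:M : 'M_1) b c D.
  rewrite scale_block_mx !scaler0 add_block_mx !addr0 add0r.
  by rewrite scalemx1.
rewrite -lineE qE (poly_eq0_off0 (q := q)) ?horner0 // => s s0.
by rewrite -qE lineE fn0.
Qed.

End PolynomialOnLines.

(** A subspace of maximal dimension inside [P] exhausts [P], since any further vector of [P] would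
    enlarge it. *)
Lemma vspace_of_subspace (K : fieldType) (X : vectType K) (P : X -> Prop) :
  P 0 -> (forall c x y, P x -> P y -> P (c *: x + y)) ->
  exists W : {vspace X}, forall x, x \in W <-> P x.
Proof.
move=> P0 PD.
pose S d := `[< exists2 W : {vspace X}, (\dim W = d)%N & forall x, x \in W -> P x >].
have S0 : exists d, S d.
  exists 0%N; apply/asboolP; exists 0%VS; rewrite ?dimv0 // => x.
  by rewrite memv0 => /eqP->.
have Sle d : S d -> (d <= \dim {:X})%N.
  by move=> /asboolP[W <- _]; rewrite dimvS ?subvf.
case: (ex_maxnP S0 Sle) => d /asboolP[W dW WP] dmax.
exists W => x; split=> [/WP//|Px]; apply/negPn/negP => xW.
have /dmax : S (\dim (W + <[x]>)).
  apply/asboolP; exists (W + <[x]>)%VS => // y /memv_addP[u /WP Pu].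
  by case=> _ /vlineP[c ->] ->; rewrite addrC; apply: PD.
rewrite -dW => le.
have: (W == W + <[x]>)%VS by rewrite eqEdim addvSl le.
by move=> /eqP We; move: xW; rewrite We memvE addvSr.
Qed.

(** * Complete reducibility and highest weight submodules *)

Section PolynomialFunctionTheory.
Variables (K : fieldType) (V : lmodType K).

Lemma polynomial_function_sum I (s : seq I) (F : I -> V -> K) :
  (forall i, polynomial_function (F i)) ->
  polynomial_function (fun v => \sum_(i <- s) F i v).
Proof.
move=> pF; elim: s => [|i s IHs].
  have -> : (fun v => \sum_(i <- [::]) F i v) = fun=> 0.
    by apply/funext => v; rewrite big_nil.
  exact: polynomial_function_cst.
have -> : (fun v => \sum_(j <- i :: s) F j v) =
          F i \+ (fun v => \sum_(j <- s) F j v).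
  by apply/funext => v; rewrite big_cons.
exact: polynomial_functionD.
Qed.

Lemma polynomial_functionZr (f : V -> K) c :
  polynomial_function f -> polynomial_function (fun v => f v * c).
Proof.
by move=> pf; apply: polynomial_functionM => //; exact: polynomial_function_cst.
Qed.

Lemma polynomial_function_scalar (l : {scalar V}) :
  polynomial_function (l : V -> K).
Proof. by exists 1%N, (fun=> l), 'X_ord0 => v; rewrite mevalXU. Qed.

End PolynomialFunctionTheory.

Section HermitianRepresentations.
Variable C : numClosedFieldType.

Section HermitianForm.
Variable m : nat.
Implicit Types (x y : 'cV[C]_m) (c : C).

Definition hdot x y : C := \sum_i x i 0 * (y i 0)^*.

Lemma hdotDl x x' y : hdot (x + x') y = hdot x y + hdot x' y.
Proof. by rewrite -big_split; apply: eq_bigr => i _; rewrite mxE mulrDl. Qed.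

Lemma hdotZl c x y : hdot (c *: x) y = c * hdot x y.
Proof. by rewrite mulr_sumr; apply: eq_bigr => i _; rewrite mxE mulrA. Qed.

Lemma hdot0l y : hdot 0 y = 0.
Proof. by rewrite -(scale0r 0) hdotZl mul0r. Qed.

Lemma hdotC x y : hdot y x = (hdot x y)^*.
Proof.
rewrite rmorph_sum; apply: eq_bigr => i _.
by rewrite rmorphM /= conjCK mulrC.
Qed.

Lemma hdotDr x y y' : hdot x (y + y') = hdot x y + hdot x y'.
Proof. by rewrite hdotC hdotDl rmorphD /= -!hdotC. Qed.

Lemma hdotZr c x y : hdot x (c *: y) = c^* * hdot x y.
Proof. by rewrite hdotC hdotZl rmorphM /= -hdotC. Qed.

Lemma hdotBr x y y' : hdot x (y - y') = hdot x y - hdot x y'.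
Proof. by rewrite -scaleN1r hdotDr hdotZr rmorphN1 mulN1r. Qed.

Lemma hdot_eq0 x : hdot x x = 0 -> x = 0.
Proof.
move=> /eqP; rewrite psumr_eq0 => [|i _]; last exact: mul_conjC_ge0.
move=> /allP h; apply/colP => i; rewrite mxE.
by have := h i (mem_index_enum _); rewrite /= mul_conjC_eq0 => /eqP.
Qed.

(** Gram-Schmidt along a spanning list: [u2], the part of the new vector orthogonal to the earlier
    ones, is the only direction left to project onto. *)
Lemma hdot_decomp (U : {vspace 'cV[C]_m}) x :
  exists x1 x2, [/\ x = x1 + x2, x1 \in U & forall y, y \in U -> hdot x2 y = 0].
Proof.
rewrite -(span_basis (vbasisP U)); move: (tval (vbasis U)) => s.
elim: s x => [|u s IHs] x.
  exists 0, x; split; rewrite ?add0r ?mem0v // => y.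
  by rewrite span_nil memv0 => /eqP->; rewrite hdotC hdot0l conjC0.
have [u1 [u2 [uE u1s u2s]]] := IHs u.
have [x1 [x2 [xE x1s x2s]]] := IHs x.
have subs y : y \in <<s>>%VS -> y \in <<u :: s>>%VS.
  by move=> ys; rewrite span_cons -[y]add0r memv_add ?mem0v.
pose c := hdot x2 u2 / hdot u2 u2.
exists (x1 + c *: u2), (x2 - c *: u2); split.
- by rewrite xE addrACA subrr addr0.
- apply: memvD; first exact: subs.
  apply: memvZ; rewrite -[u2](addKr u1) -uE memvD //.
    by rewrite memvN subs.
  by rewrite memv_span ?mem_head.
move=> y; rewrite span_cons => /memv_addP[_ /vlineP[d ->] [y' y's ->]].
have ortho w : w \in <<s>>%VS -> hdot (x2 - c *: u2) w = 0.
  by move=> ws; rewrite -scaleNr hdotDl hdotZl x2s ?u2s // mulr0 addr0.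
rewrite hdotDr hdotZr (ortho y') // addr0 uE hdotDr ortho // add0r.
rewrite -scaleNr hdotDl hdotZl mulNr /c.
(* If [u2] has norm 0 then [u2] is 0, and the value given to the quotient [c] does not matter. *)
have [u20|u20] := eqVneq (hdot u2 u2) 0; last by rewrite divfK // subrr mulr0.
by rewrite (hdot_eq0 u20) [hdot x2 0]hdotC hdot0l conjC0 !mul0r subr0 mulr0.
Qed.

End HermitianForm.

Definition adjmx n p (A : 'M[C]_(n, p)) : 'M[C]_(p, n) := (map_mx Num.conj A)^T.

Lemma adjmx_unit n (A : 'M[C]_n) : (adjmx A \in unitmx) = (A \in unitmx).
Proof. by rewrite unitmx_tr map_unitmx. Qed.

Lemma hdot_adj m (A : 'M[C]_m) x y : hdot (A *m x) y = hdot x (adjmx A *m y).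
Proof.
rewrite /hdot; under eq_bigr do rewrite mxE mulr_suml.
rewrite exchange_big /=; apply: eq_bigr => j _.
rewrite mxE rmorph_sum mulr_sumr; apply: eq_bigr => i _.
by rewrite !mxE rmorphM /= conjCK mulrCA mulrA.
Qed.

Lemma upper_unitriangularW n (u : 'M[C]_n) :
  upper_unitriangular u -> upper_triangular u.
Proof.
by move=> hu i j ji; rewrite hu ?(ltnW ji) // -val_eqE gtn_eqF.
Qed.

Lemma unitriangular_unit n (u : 'M[C]_n) : upper_unitriangular u -> u \in unitmx.
Proof.
move=> hu; rewrite -unitmx_tr unitmxE det_trig.
  rewrite big1 ?unitr1 // => i _.
  by rewrite mxE hu ?eqxx.
by apply/is_trig_mxP => i j ij; rewrite mxE hu ?(ltnW ij) // -val_eqE gtn_eqF.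
Qed.

(* A polynomial representation of the monoid of matrices, unitary in the weak
   sense that the standard Hermitian form intertwines [g] and its adjoint; this
   replaces averaging over the unitary group in the proof of complete
   reducibility. *)
Definition star_representation n m (rho : 'M[C]_n -> 'M[C]_m) : Prop :=
  [/\ rho 1%:M = 1%:M, {morph rho : g h / g *m h},
      forall g, adjmx (rho g) = rho (adjmx g)
    & forall i j, polynomial_function (fun g => rho g i j)].

Definition stable_subspace n m (rho : 'M[C]_n -> 'M[C]_m)
    (U : {vspace 'cV[C]_m}) : Prop :=
  forall g, g \in unitmx -> forall u, u \in U -> rho g *m u \in U.

Section HighestWeightSubmodule.
Variables (n m : nat) (rho : 'M[C]_n -> 'M[C]_m).
Hypothesis rhoP : star_representation rho.

Let rho1 : rho 1%:M = 1%:M. Proof. by have [] := rhoP. Qed.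
Let rhoM : {morph rho : g h / g *m h}. Proof. by have [] := rhoP. Qed.
Let rho_adj g : adjmx (rho g) = rho (adjmx g). Proof. by have [] := rhoP. Qed.

Lemma star_hdot g x y : hdot (rho g *m x) y = hdot x (rho (adjmx g) *m y).
Proof. by rewrite hdot_adj rho_adj. Qed.

Lemma star_coef_on_lines x y :
  polynomial_on_lines (fun g => hdot (rho g *m x) y).
Proof.
have [_ _ _ pf] := rhoP; apply: polynomial_function_on_lines.
apply: polynomial_function_sum => i; apply: polynomial_functionZr.
rewrite (_ : (fun _ => _) = fun g => \sum_j rho g i j * x j 0).
  by apply: polynomial_function_sum => j; exact: polynomial_functionZr.
by rewrite funeqE => g; rewrite mxE.
Qed.

(** The defect [rho g *m x1 - c *: x1] lies in [U]. It equals [c *: x2 - rho g *m x2], which is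
    orthogonal to [U] because the adjoint of [g] preserves [U]; so it is 0. *)
Lemma eigen_components (U : {vspace 'cV[C]_m}) g c x1 x2 :
  stable_subspace rho U -> g \in unitmx ->
  x1 \in U -> (forall y, y \in U -> hdot x2 y = 0) ->
  rho g *m (x1 + x2) = c *: (x1 + x2) ->
  rho g *m x1 = c *: x1 /\ rho g *m x2 = c *: x2.
Proof.
move=> Us gu x1U x2U E.
have E' : rho g *m x1 - c *: x1 = c *: x2 - rho g *m x2.
  apply/eqP; rewrite subr_eq addrAC [_ + c *: x1]addrC -scalerDr -E mulmxDr.
  by rewrite addrK.
have /hdot_eq0/eqP : hdot (rho g *m x1 - c *: x1) (rho g *m x1 - c *: x1) = 0.
  have : rho g *m x1 - c *: x1 \in U by rewrite memvB ?memvZ ?Us.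
  move: (_ - _) E' => y yE yU; rewrite {1}yE.
  rewrite -scaleN1r hdotDl !hdotZl star_hdot x2U // mulr0 add0r.
  by rewrite x2U ?mulr0 // Us // adjmx_unit.
rewrite subr_eq0 => /eqP E1; split=> //.
by move/eqP: E'; rewrite E1 subrr eq_sym subr_eq0 => /eqP.
Qed.

Lemma stable_orthogonal (U : {vspace 'cV[C]_m}) : stable_subspace rho U ->
  exists2 V : {vspace 'cV[C]_m}, stable_subspace rho V &
    forall y, y \in V <-> (forall u, u \in U -> hdot y u = 0).
Proof.
move=> Ust.
have [V VP] : exists V : {vspace 'cV[C]_m}, forall y, y \in V <->
    (forall u, u \in U -> hdot y u = 0).
  apply: vspace_of_subspace => [v _|c y y' py py' v vN]; first exact: hdot0l.
  by rewrite hdotDl hdotZl py ?py' // mulr0 addr0.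
exists V => // g gu y /VP yU; apply/VP => v vU.
by rewrite star_hdot yU // Ust // adjmx_unit.
Qed.

Variable chi : 'M[C]_n -> C.
Hypothesis chi1 : forall u, upper_unitriangular u -> chi u = 1.

(** The adjoint carries the lower unitriangular [l] to the other argument as an upper unitriangular
    matrix, which fixes [z']. Such a coefficient is thus known on the big cell. *)
Lemma highest_weight_coef z z' b l :
  rho b *m z = chi b *: z ->
  (forall u, upper_unitriangular u -> rho u *m z' = z') ->
  upper_unitriangular l^T ->
  hdot (rho (l *m b) *m z) z' = chi b * hdot z z'.
Proof.
move=> zE z'E hl; rewrite rhoM -mulmxA zE -scalemxAr hdotZl star_hdot z'E //.
move=> i j ij; have := hl i j ij; rewrite /adjmx !mxE => ->.
by rewrite rmorph_nat.
Qed.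

Variables (A : lmodType C) (psi : {linear 'cV[C]_m -> A}) (x : 'cV[C]_m).
Hypothesis ker_psi : forall g y, g \in unitmx -> psi y = 0 -> psi (rho g *m y) = 0.
Hypothesis psi_x : psi x != 0.
Hypothesis psi_eigen : forall b, upper_triangular b -> b \in unitmx ->
  psi (rho b *m x) = chi b *: psi x.

(** The vector [z] is the component of [x] orthogonal to the kernel of [psi]. On that complement
    [psi] is injective, so [z] inherits the eigenvalues of [psi x]. The submodule [W] generated by
    [z] is irreducible because [z] cannot have nonzero components both in a stable subspace and in
    its complement. *)
Lemma highest_weight_submodule :
  exists (W : {vspace 'cV[C]_m}) (z : 'cV[C]_m),
  [/\ stable_subspace rho W,
      z \in W /\ z != 0,
      forall b, upper_triangular b -> b \in unitmx -> rho b *m z = chi b *: z,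
      forall w, w \in W -> psi w = 0 -> w = 0
    & forall U, (U <= W)%VS -> stable_subspace rho U -> U = 0%VS \/ U = W].
Proof.
have [N NP] : exists N : {vspace 'cV[C]_m}, forall y, y \in N <-> psi y = 0.
  apply: vspace_of_subspace => [|c y y' py py']; first by rewrite linear0.
  by rewrite linearP py py' scaler0 addr0.
have [x0 [z [xE x0N zN]]] := hdot_decomp N x.
have Nst : stable_subspace rho N by move=> g gu y /NP/(ker_psi gu)/NP.
have psi_z : psi z = psi x by rewrite xE linearD (NP x0).1 // add0r.
have z0 : z != 0 by apply: contraNneq psi_x => z0; rewrite -psi_z z0 linear0.
have Northo y : (forall u, u \in N -> hdot y u = 0) -> psi y = 0 -> y = 0.
  by move=> yN /NP/yN/hdot_eq0.
have z_eigen b : upper_triangular b -> b \in unitmx ->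
    rho b *m z = chi b *: z.
  move=> hb ub; apply/eqP; rewrite -subr_eq0; apply/eqP/Northo => [u uN|].
    rewrite -scaleNr hdotDl hdotZl star_hdot !zN ?mulr0 ?addr0 //.
    by apply: Nst; rewrite ?adjmx_unit.
  have E : rho b *m z = rho b *m x - rho b *m x0.
    by rewrite xE mulmxDr addrC addKr.
  rewrite E !linearB /= psi_eigen // linearZ /= psi_z.
  by rewrite (ker_psi ub ((NP x0).1 x0N)) subr0 subrr.
(* [W] is the intersection of all stable subspaces containing [z]. *)
pose P y := forall U, stable_subspace rho U -> z \in U -> y \in U.
have [W WP] : exists W : {vspace 'cV[C]_m}, forall y, y \in W <-> P y.
  apply: vspace_of_subspace => [U _ _|c y y' py py' U Ust zU].
    exact: mem0v.
  by rewrite memvD ?memvZ //; [exact: py | exact: py'].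
have zW : z \in W by apply/WP => U.
have Wst : stable_subspace rho W.
  by move=> g gu y /WP Py; apply/WP => U Ust zU; exact: Ust (Py U Ust zU).
have Wmin U w : stable_subspace rho U -> z \in U -> w \in W -> w \in U.
  by move=> Ust zU /WP; apply.
(* The vectors whose whole orbit is orthogonal to [v] form a stable subspace. It contains [z], hence
   [W], hence [v] itself. *)
have Wtot v : v \in W -> (forall g, hdot (rho g *m z) v = 0) -> v = 0.
  move=> vW hv.
  pose Q y := forall g, g \in unitmx -> hdot (rho g *m y) v = 0.
  have [U UP] : exists U : {vspace 'cV[C]_m}, forall y, y \in U <-> Q y.
    apply: vspace_of_subspace => [g gu|c y y' qy qy' g gu].
      by rewrite mulmx0 hdot0l.
    by rewrite mulmxDr -scalemxAr hdotDl hdotZl qy ?qy' // mulr0 addr0.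
  have /(Wmin U v) : stable_subspace rho U.
    move=> g gu y /UP Qy; apply/UP => h hu.
    by rewrite mulmxA -rhoM Qy // unitmx_mul hu.
  have zU : z \in U by apply/UP.
  move=> /(_ zU vW)/UP/(_ 1%:M (unitmx1 _ _)).
  by rewrite rho1 mul1mx => /hdot_eq0.
exists W, z; split=> //.
  (* The complement of the kernel is stable and contains [z], so it contains [W]. *)
  move=> w wW; apply: Northo => u uN.
  have [U Ust UP] := stable_orthogonal Nst.
  by apply: (UP w).1 => //; apply: Wmin wW; last exact/UP.
move=> U UW Ust.
have [z1 [z2 [zE z1U z2U]]] := hdot_decomp U z.
have z_comp b : upper_triangular b -> b \in unitmx ->
    rho b *m z1 = chi b *: z1 /\ rho b *m z2 = chi b *: z2.
  move=> hb ub; apply: (eigen_components Ust) => //.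
  by rewrite -zE z_eigen.
have z_unip u : upper_unitriangular u -> rho u *m z1 = z1 /\ rho u *m z2 = z2.
  move=> hu.
  have := z_comp u (upper_unitriangularW hu) (unitriangular_unit hu).
  by rewrite chi1 // !scale1r.
have z1z2 : hdot z1 z2 = 0 by rewrite hdotC z2U ?conjC0.
have z1W : z1 \in W by apply: (subvP UW).
have z2W : z2 \in W by rewrite -[z2](addKr z1) -zE memvD ?memvN.
pose c1 := hdot z1 z1; pose c2 := hdot z2 z2.
have c1r : c1^* = c1 by rewrite -hdotC.
have c2r : c2^* = c2 by rewrite -hdotC.
(* On the big cell the coefficients of [z] against [z1] and [z2] are [chi b * c1] and [chi b * c2].
   They are therefore proportional for all [g], and this combination is orthogonal to every
   [rho g *m z]. *)
have : c1 *: z2 - c2 *: z1 = 0.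
  apply: Wtot; first by rewrite memvB ?memvZ.
  apply: big_cell_dense (star_coef_on_lines _ _) _ => l b hl hb ub.
  rewrite hdotBr !hdotZr c1r c2r.
  rewrite !(highest_weight_coef (b := b)) ?z_eigen // => [|u /z_unip[]|u /z_unip[]] //.
  rewrite zE !hdotDl z1z2 (hdotC z1 z2) z1z2 conjC0 add0r addr0 -/c1 -/c2.
  by rewrite mulrCA [c2 * _]mulrCA [c2 * _]mulrC subrr.
(* Pairing with [z1] leaves [c1 * c2 = 0]. If [z2 = 0] then [z] lies in [U], and [U] is all of [W];
   if [z1 = 0] then [W] is orthogonal to [U], and [U] is 0. *)
move=> /(congr1 (fun v => hdot v z1)); rewrite hdot0l -scaleNr hdotDl !hdotZl.
rewrite (hdotC z1 z2) z1z2 conjC0 mulr0 add0r -/c1 => /eqP.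
rewrite mulf_eq0 oppr_eq0 => /orP[] /eqP/hdot_eq0 zi0.
  right; apply/eqP; rewrite eqEsubv UW; apply/subvP => w; apply: Wmin => //.
  by rewrite zE zi0 addr0.
left; apply/eqP; rewrite -subv0; apply/subvP => u uU.
rewrite memv0; apply/eqP/hdot_eq0.
have [V Vst VP] := stable_orthogonal Ust.
apply: (VP u).1 => //; apply: Wmin ((subvP UW) u uU) => //.
by apply/VP => v; rewrite zE zi0 add0r; exact: z2U.
Qed.

End HighestWeightSubmodule.
End HermitianRepresentations.

(** * From highest weight functions to modules in the coordinate ring *)

Section Occurrence.
Variables (C : numClosedFieldType) (n r : nat).
Local Notation V := (dhomog n C r).
Local Notation X := (@ESP_orbit_closure C n r).

(** On invertible upper triangular matrices this is the character of the Borel subgroup that extends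
    the torus character [lambda]. *)
Definition diag_character (lambda : 'rV[int]_n) (b : 'M[C]_n) : C :=
  \prod_i b i i ^ lambda 0 i.

Lemma diag_character1 lambda u :
  upper_unitriangular u -> diag_character lambda u = 1.
Proof. by move=> hu; apply: big1 => i _; rewrite hu // eqxx exp1rz. Qed.

Section Span.
Variables (m : nat) (rho : 'M[C]_n -> 'M[C]_m) (a : 'I_m -> V -> C).
Hypothesis rhoP : star_representation rho.
Hypothesis pa : forall i, polynomial_function (a i).
Hypothesis a_cov : forall (g : GL C n) i P,
  a i (precomp g P) = \sum_j rho g j i * a j P.

Definition lincomb (y : 'cV[C]_m) (P : V) : C := \sum_i y i 0 * a i P.

Lemma lincomb_cov (g : GL C n) y P :
  lincomb y (precomp g P) = lincomb (rho g *m y) P.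
Proof.
rewrite /lincomb; under eq_bigr do rewrite a_cov mulr_sumr.
rewrite exchange_big /=; apply: eq_bigr => i _.
rewrite mxE mulr_suml; apply: eq_bigr => j _.
by rewrite mulrA [y j 0 * _]mulrC.
Qed.

Fact lincomb_regular y :
  (fun P : X => lincomb y (val P)) \in regular_function X.
Proof.
apply/regular_functionP; exists (lincomb y) => //.
apply: polynomial_function_sum => i.
by apply: polynomial_functionM => //; exact: polynomial_function_cst.
Qed.

(** The equivariant map from the star representation to the coordinate ring, used as [psi] in
    [highest_weight_submodule]. *)
Definition lincomb_coord (y : 'cV[C]_m) : coordinate_ring X :=
  RegularFunction (lincomb_regular y).

Fact lincomb_coord_is_linear : linear lincomb_coord.
Proof.
move=> c y y'; apply: val_inj; apply/funext => P /=.
transitivity (c * lincomb y (val P) + lincomb y' (val P)); last by [].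
rewrite /lincomb mulr_sumr -big_split; apply: eq_bigr => i _.
by rewrite !mxE mulrDl -mulrA.
Qed.
HB.instance Definition _ :=
  GRing.isLinear.Build C 'cV[C]_m (coordinate_ring X) _ lincomb_coord
    lincomb_coord_is_linear.

Lemma lincomb_coord_act (g : GL C n) y :
  lincomb_coord (rho g *m y) = coordinate_ring_act g (lincomb_coord y).
Proof.
by apply: val_inj; apply/funext => P /=; rewrite -lincomb_cov.
Qed.

Lemma coordinate_ring_act0 (g : GL C n) :
  coordinate_ring_act g 0 = 0 :> coordinate_ring X.
Proof. by apply: val_inj; apply/funext. Qed.

Section SubRepresentation.
Variable W : {vspace 'cV[C]_m}.
Hypothesis Wst : stable_subspace rho W.

(** For stable [W] the projection [vsproj] only changes the type, since its argument already lies in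
    [W]. *)
Definition sub_rep (g : GL C n) : 'End(subvs_of W) :=
  linfun (vsproj W \o (mulmx (rho g) \o vsval)).

Lemma sub_repE g w : vsval (sub_rep g w) = rho g *m vsval w.
Proof. by rewrite lfunE /= vsprojK // Wst ?Defs.GL_unit ?subvsP. Qed.

Lemma sub_rep_rational : rational_representation sub_rep.
Proof.
have [rho1 rhoM _ prho] := rhoP.
split=> [|g h|l w].
- by apply/lfunP => w; apply: val_inj; rewrite /= sub_repE rho1 mul1mx id_lfunE.
- apply/lfunP => w; apply: val_inj.
  by rewrite comp_lfunE /= !sub_repE /= rhoM mulmxA.
(* The exponent of the determinant is 0: the entries of [rho g] are polynomials in those of [g]. *)
exists 0%N, (fun g => l (vsproj W (rho g *m vsval w))); split; last first.
  by move=> g; rewrite expr0 divr1 lfunE.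
pose e i : 'cV[C]_m := delta_mx i 0.
have -> : (fun g => l (vsproj W (rho g *m vsval w))) =
    fun g => \sum_i (\sum_j rho g i j * vsval w j 0) * l (vsproj W (e i)).
  apply/funext => g; rewrite [rho g *m _]matrix_sum_delta !linear_sum /=.
  apply: eq_bigr => i _; rewrite big_ord1 !linearZ /= !mxE.
  by congr (_ * _).
apply: polynomial_function_sum => i; apply: polynomial_functionZr.
by apply: polynomial_function_sum => j; exact: polynomial_functionZr.
Qed.

Lemma sub_rep_irreducible : W != 0%VS ->
  (forall U, (U <= W)%VS -> stable_subspace rho U -> U = 0%VS \/ U = W) ->
  irreducible_representation sub_rep.
Proof.
move=> W0 Wirr; split.
  apply: contraNneq W0 => f0; rewrite -subv0; apply/subvP => w wW.
  have /eqP w0 : vsproj W w == 0 by rewrite -memv0 -f0 memvf.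
  by rewrite -(vsprojK wW) w0 linear0 mem0v.
move=> U Ust; pose U' := (linfun vsval @: U)%VS.
have U'P w : (vsval w \in U') = (w \in U).
  apply/memv_imgP/idP => [[u uU]|wU]; last by exists w; rewrite ?lfunE.
  by rewrite lfunE => /val_inj ->.
have U'W : (U' <= W)%VS.
  by apply/subvP => _ /memv_imgP[u _ ->]; rewrite lfunE subvsP.
have U'st : stable_subspace rho U'.
  move=> g gu _ /memv_imgP[u uU ->]; rewrite lfunE.
  have /subvP/(_ _ (memv_img _ uU)) := Ust (MkGL gu).
  by rewrite -U'P sub_repE.
case: (Wirr U' U'W U'st) => U'E; [left|right]; apply/vspaceP => w.
  by rewrite -U'P U'E !memv0 -(inj_eq subvs_inj).
by rewrite -U'P U'E subvsP memvf.
Qed.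

End SubRepresentation.

(** Nonvanishing at one point of the orbit makes the function nonzero in the coordinate ring. The
    irreducible module is then realized on the submodule [W] of the star representation, where
    [lincomb_coord] is injective. *)
Lemma occurs_lincomb (x : 'cV[C]_m) lambda :
  (forall b : GL C n, upper_triangular b -> forall P,
     lincomb x (precomp b P) = diag_character lambda b * lincomb x P) ->
  (exists g, lincomb x (precomp g (ESP C n r)) != 0) ->
  @occurs C n r lambda.
Proof.
move=> x_eigen [g0 xg0].
have [||||W [z [Wst [zW z0] z_eigen Winj Wirr]]] :=
  @highest_weight_submodule C n m rho rhoP (diag_character lambda) _ _
    lincomb_coord x.
- exact: diag_character1.
- move=> g y gu y0.
  by have /= -> := lincomb_coord_act (MkGL gu) y; rewrite y0 coordinate_ring_act0.
- have orb : X (precomp g0 (ESP C n r)).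
    by move=> f _ f0; apply: f0; exists g0.
  pose P0 : X := SigSub (mem_set orb).
  apply: contraNneq xg0 => x0.
  by have /= -> := congr1 (fun f : coordinate_ring X => f P0) x0.
- move=> b hb ub; have /= -> := lincomb_coord_act (MkGL ub) x.
  by apply: val_inj; apply/funext => P /=; rewrite (x_eigen (MkGL ub)).
have W0 : W != 0%VS by apply: contraNneq z0 => W0; rewrite -memv0 -W0.
exists (subvs_of W), (sub_rep W), (lincomb_coord \o vsval); split.
- split; [exact: sub_rep_rational|exact: sub_rep_irreducible|].
  exists (vsproj W z); split.
  + by apply: contraNneq z0 => Wz0; rewrite -(vsprojK zW) Wz0 linear0.
  + move=> u hu; apply: val_inj; rewrite /= sub_repE // vsprojK //.
    rewrite z_eigen ?Defs.GL_unit ?diag_character1 ?scale1r //.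
    exact: upper_unitriangularW.
  + move=> t d td; apply: val_inj; rewrite /= sub_repE // vsprojK //.
    rewrite z_eigen ?Defs.GL_unit //; last first.
      by move=> i j ji; rewrite td mxE -val_eqE gtn_eqF.
    congr (_ *: _); apply: eq_bigr => i _.
    by rewrite td mxE eqxx.
- move=> w w' /= E; apply: val_inj; apply/eqP; rewrite -subr_eq0; apply/eqP.
  by apply: Winj; rewrite ?linearB /= ?E ?subrr // memvB ?subvsP.
- by move=> g w; rewrite /= sub_repE // lincomb_coord_act.
Qed.

End Span.
End Occurrence.

(** * Covariants *)

Section StarFamilies.
Variables (C : numClosedFieldType) (n : nat).

(** Star representations indexed by an arbitrary finite type, so that tensor products and direct
    sums are indexed by product and sum types. *)
Definition star_family (T : finType) (rho : 'M[C]_n -> T -> T -> C) : Prop :=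
  [/\ forall s t, rho 1%:M s t = (s == t)%:R,
      forall g h s t, rho (g *m h) s t = \sum_u rho g s u * rho h u t,
      forall g s t, (rho g s t)^* = rho (adjmx g) t s
    & forall s t, polynomial_function (fun g => rho g s t)].

Lemma star_family_trivial :
  star_family (fun (_ : 'M[C]_n) (_ _ : unit) => 1).
Proof.
split=> [[] [] //|g h _ _|g _ _|_ _].
- by rewrite big_const card_unit /= mulr1 addr0.
- by rewrite conjC1.
- exact: polynomial_function_cst.
Qed.

Lemma star_family_standard : star_family (fun (g : 'M[C]_n) i j => g i j).
Proof.
split=> [i j|g h i j|g i j|i j]; rewrite ?mxE //.
have lin : linear (fun g : 'M[C]_n => g i j : C^o).
  by move=> c g h; rewrite !mxE.
pose l : {scalar 'M[C]_n} := HB.pack (fun g : 'M[C]_n => g i j)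
  (GRing.isLinear.Build _ _ _ _ _ lin).
exact: (polynomial_function_scalar l).
Qed.

Lemma star_family_prod (T1 T2 : finType) rho1 rho2 :
  @star_family T1 rho1 -> @star_family T2 rho2 ->
  star_family (fun g (s t : T1 * T2) => rho1 g s.1 t.1 * rho2 g s.2 t.2).
Proof.
move=> [one1 mul1 adj1 pol1] [one2 mul2 adj2 pol2].
split=> [[s1 s2] [t1 t2]|g h [s1 s2] [t1 t2]|g s t|s t] /=.
- by rewrite one1 one2 -natrM mulnb.
- rewrite mul1 mul2 big_distrlr /= pair_bigA; apply: eq_bigr => u _ /=.
  by rewrite mulrACA.
- by rewrite rmorphM /= adj1 adj2.
- exact: polynomial_functionM.
Qed.

Lemma star_family_sum (T1 T2 : finType) rho1 rho2 :
  @star_family T1 rho1 -> @star_family T2 rho2 ->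
  star_family (fun g (s t : T1 + T2) =>
    match s, t with
    | inl s1, inl t1 => rho1 g s1 t1
    | inr s2, inr t2 => rho2 g s2 t2
    | _, _ => 0
    end).
Proof.
move=> [one1 mul1 adj1 pol1] [one2 mul2 adj2 pol2].
split=> [[s|s] [t|t]|g h [s|s] [t|t]|g [s|s] [t|t]|[s|s] [t|t]] //=;
  rewrite ?conjC0 //; try exact: polynomial_function_cst.
all: rewrite big_sumType /=.
- by rewrite [X in _ + X]big1 ?addr0 // => u _; rewrite mul0r.
- by rewrite !big1 ?addr0 // => u _; rewrite ?mul0r ?mulr0.
- by rewrite !big1 ?addr0 // => u _; rewrite ?mul0r ?mulr0.
- by rewrite big1 ?add0r // => u _; rewrite mul0r.
Qed.

End StarFamilies.

(** * Directional derivatives under linear substitution *)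

Section DirectionalDerivatives.
Variables (C : numClosedFieldType) (n : nat).
Implicit Types (p q : {mpoly C[n]}) (g : 'M[C]_n) (v : 'cV[C]_n).

(** The chain rule. The identity is stable under linear combinations and products, so it is enough
    to check it on the variables. *)
Lemma mderiv_linear_subst g p j :
  (p \mPo linear_subst g)^`M(j) =
  \sum_i g i j *: (p^`M(i) \mPo linear_subst g).
Proof.
pose Q p := forall j, (p \mPo linear_subst g)^`M(j) =
  \sum_i g i j *: (p^`M(i) \mPo linear_subst g).
have QD p1 p2 : Q p1 -> Q p2 -> Q (p1 + p2).
  move=> Q1 Q2 k; rewrite comp_mpolyD mderivD Q1 Q2 -big_split.
  by apply: eq_bigr => i _; rewrite mderivD comp_mpolyD scalerDr.
have QZ c p1 : Q p1 -> Q (c *: p1).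
  move=> Q1 k; rewrite comp_mpolyZ mderivZ Q1 scaler_sumr.
  by apply: eq_bigr => i _; rewrite mderivZ comp_mpolyZ !scalerA mulrC.
have Q1 : Q 1.
  move=> k; rewrite rmorph1 -mpolyC1 mderivC big1 // => i _.
  by rewrite mderivC linear0 scaler0.
have QM p1 p2 : Q p1 -> Q p2 -> Q (p1 * p2).
  move=> Qp Qq k; rewrite rmorphM mderivM Qp Qq mulr_suml mulr_sumr -big_split.
  apply: eq_bigr => i _; rewrite mderivM comp_mpolyD !rmorphM scalerDr.
  by congr (_ + _); rewrite -?scalerAl -?scalerAr.
have subU (i : 'I_n) : (U_(i) - U_(i) = 0)%MM.
  by apply/mnmP => l; rewrite mnmBE subnn mnm0E.
have QX i : Q 'X_i.
  move=> k; rewrite comp_mpolyXU -tnth_nth tnth_mktuple linear_sum /=.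
  rewrite (bigD1 k) //= [RHS](bigD1 i) //= !big1 => [|l li|l lk].
  - rewrite mderivZ !mderivX !mnm1E !eqxx !scale1r !subU mpolyX0.
    by rewrite rmorph1.
  - rewrite mderivX mnm1E eq_sym (negbTE li) scale0r linear0 scaler0 //.
  - by rewrite mderivZ mderivX mnm1E (negbTE lk) scale0r scaler0.
have QXn i k : Q ('X_i ^+ k).
  elim: k => [|k IHk]; first by rewrite expr0.
  by rewrite exprS; exact: (QM _ _ (QX i) IHk).
have QXm m : Q 'X_[m].
  by rewrite mpolyXE_id; exact: (big_ind Q Q1 QM (fun i _ => QXn i _)).
suff: forall p, Q p by apply.
apply: mpolyind => {p j} [j|c m p _ _ Qp j].
  by have := QZ 0 _ Q1 j; rewrite scale0r.
exact: (QD _ _ (QZ _ _ (QXm m)) Qp j).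
Qed.

Definition dirderiv v p : {mpoly C[n]} := \sum_i v i 0 *: p^`M(i).

Fact dirderiv_is_linear v : linear (dirderiv v).
Proof.
move=> c p q; rewrite /dirderiv scaler_sumr -big_split; apply: eq_bigr => i _.
by rewrite mderivD mderivZ scalerDr !scalerA mulrC.
Qed.
HB.instance Definition _ v :=
  GRing.isLinear.Build C {mpoly C[n]} {mpoly C[n]} _ (dirderiv v)
    (dirderiv_is_linear v).

Lemma dirderivM v p q : dirderiv v (p * q) = dirderiv v p * q + p * dirderiv v q.
Proof.
rewrite /dirderiv mulr_suml mulr_sumr -big_split; apply: eq_bigr => i _.
by rewrite mderivM scalerDr scalerAl scalerAr.
Qed.

Lemma dirderivZl c v p : dirderiv (c *: v) p = c *: dirderiv v p.
Proof. by rewrite scaler_sumr; apply: eq_bigr => i _; rewrite mxE scalerA. Qed.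

Lemma dirderiv_delta i p : dirderiv (delta_mx i 0) p = p^`M(i).
Proof.
rewrite /dirderiv (bigD1 i) //= mxE !eqxx scale1r big1 ?addr0 // => j ji.
by rewrite mxE (negbTE ji) scale0r.
Qed.

Lemma dirderiv_comp g v p :
  dirderiv v (p \mPo linear_subst g) = dirderiv (g *m v) p \mPo linear_subst g.
Proof.
rewrite /dirderiv linear_sum /=; under eq_bigr do
  rewrite mderiv_linear_subst scaler_sumr.
rewrite exchange_big; apply: eq_bigr => i _.
rewrite comp_mpolyZ mxE scaler_suml; apply: eq_bigr => j _.
by rewrite scalerA mulrC.
Qed.

Lemma iter_dirderiv_comp g v p k :
  iter k (dirderiv v) (p \mPo linear_subst g) =
  iter k (dirderiv (g *m v)) p \mPo linear_subst g.
Proof. by elim: k => //= k ->; rewrite dirderiv_comp. Qed.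

Lemma comp_linear_subst0 g p :
  (p \mPo linear_subst g).@[fun=> 0] = p.@[fun=> 0].
Proof.
rewrite comp_mpoly_meval; apply: meval_eq => i; rewrite tnth_mktuple.
by rewrite linear_sum big1 //= => j _; rewrite mevalZ mevalXU mulr0.
Qed.

End DirectionalDerivatives.

Section Covariants.
Variables (C : numClosedFieldType) (n r : nat).
Local Notation V := (dhomog n C r).
Local Notation dseq s P := (foldr (@mderiv n C) (P : {mpoly C[n]}) s).

(* The functions on [V] generating a representation of [GL_n] that is a
   quotient of a star representation. *)
Definition covariant (F : V -> C) : Prop :=
  exists (T : finType) (rho : 'M[C]_n -> T -> T -> C) (a : T -> V -> C)
    (x : T -> C),
  [/\ star_family rho, forall t, polynomial_function (a t),
      forall (g : GL C n) t P, a t (precomp g P) = \sum_s rho g s t * a s P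
    & forall P, F P = \sum_t x t * a t P].

Lemma covariant_cst c : covariant (fun=> c).
Proof.
exists unit, (fun _ _ _ => 1), (fun _ _ => 1), (fun=> c); split.
- exact: star_family_trivial.
- by move=> _; exact: polynomial_function_cst.
- by move=> _ _ _; rewrite big_const card_unit /= mulr1 addr0.
- by move=> _; rewrite big_const card_unit /= mulr1 addr0.
Qed.

Lemma covariantM F G :
  covariant F -> covariant G -> covariant (fun P => F P * G P).
Proof.
move=> [T1 [rho1 [a1 [x1 [st1 pol1 cov1 E1]]]]].
move=> [T2 [rho2 [a2 [x2 [st2 pol2 cov2 E2]]]]].
exists (T1 * T2)%type, (fun g s t => rho1 g s.1 t.1 * rho2 g s.2 t.2),
  (fun t P => a1 t.1 P * a2 t.2 P), (fun t => x1 t.1 * x2 t.2); split.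
- exact: star_family_prod.
- by move=> t; exact: polynomial_functionM.
- move=> g t P; rewrite cov1 cov2 big_distrlr /= pair_bigA.
  by apply: eq_bigr => u _; rewrite mulrACA.
- move=> P; rewrite E1 E2 big_distrlr /= pair_bigA.
  by apply: eq_bigr => u _; rewrite mulrACA.
Qed.

Lemma covariantD F G :
  covariant F -> covariant G -> covariant (fun P => F P + G P).
Proof.
move=> [T1 [rho1 [a1 [x1 [st1 pol1 cov1 E1]]]]].
move=> [T2 [rho2 [a2 [x2 [st2 pol2 cov2 E2]]]]].
exists (T1 + T2)%type, (fun g (s t : T1 + T2) =>
    match s, t with
    | inl s1, inl t1 => rho1 g s1 t1
    | inr s2, inr t2 => rho2 g s2 t2
    | _, _ => 0
    end),
  (fun t => match t with inl t1 => a1 t1 | inr t2 => a2 t2 end),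
  (fun t => match t with inl t1 => x1 t1 | inr t2 => x2 t2 end); split.
- exact: star_family_sum.
- by case=> t.
- move=> g [t|t] P; rewrite big_sumType /= ?cov1 ?cov2.
    by rewrite [X in _ = _ + X]big1 ?addr0 // => s _; rewrite mul0r.
  by rewrite [X in _ = X + _]big1 ?add0r // => s _; rewrite mul0r.
- by move=> P; rewrite E1 E2 big_sumType.
Qed.

Lemma covariant_ext F G : F =1 G -> covariant F -> covariant G.
Proof. by move=> /funext->. Qed.

Lemma covariant_sum I (s : seq I) (Q : pred I) (F : I -> V -> C) :
  (forall i, covariant (F i)) -> covariant (fun P => \sum_(i <- s | Q i) F i P).
Proof.
move=> cF; elim: s => [|i s IHs].
  by apply: covariant_ext (covariant_cst 0) => P; rewrite big_nil.
case Qi: (Q i); last first.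
  by apply: covariant_ext IHs => P; rewrite big_cons Qi.
by apply: covariant_ext (covariantD (cF i) IHs) => P; rewrite big_cons Qi.
Qed.

Lemma covariant_prod I (s : seq I) (Q : pred I) (F : I -> V -> C) :
  (forall i, covariant (F i)) ->
  covariant (fun P => \prod_(i <- s | Q i) F i P).
Proof.
move=> cF; elim: s => [|i s IHs].
  by apply: covariant_ext (covariant_cst 1) => P; rewrite big_nil.
case Qi: (Q i); last first.
  by apply: covariant_ext IHs => P; rewrite big_cons Qi.
by apply: covariant_ext (covariantM (cF i) IHs) => P; rewrite big_cons Qi.
Qed.

Lemma covariant_det m (A : V -> 'M[C]_m) :
  (forall i j, covariant (fun P => A P i j)) -> covariant (fun P => \det (A P)).
Proof.
move=> cA; apply: covariant_sum => s; apply: covariantM.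
  exact: covariant_cst.
exact: covariant_prod.
Qed.

Lemma covariant_mulmx m1 m2 m3 (A : V -> 'M[C]_(m1, m2)) (B : V -> 'M_(m2, m3)) :
  (forall i j, covariant (fun P => A P i j)) ->
  (forall i j, covariant (fun P => B P i j)) ->
  forall i j, covariant (fun P => (A P *m B P) i j).
Proof.
move=> cA cB i j.
apply: (@covariant_ext (fun P => \sum_k A P i k * B P k j)) => [P|].
  by rewrite mxE.
by apply: covariant_sum => k; apply: covariantM.
Qed.

Lemma covariant_adj m (A : V -> 'M[C]_m) :
  (forall i j, covariant (fun P => A P i j)) ->
  forall i j, covariant (fun P => (\adj (A P)) i j).
Proof.
move=> cA i j; apply: (@covariant_ext (fun P => cofactor (A P) j i)) => [P|].
  by rewrite mxE.
apply: covariantM; first exact: covariant_cst.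
apply: covariant_det => k l.
by apply: covariant_ext (cA (lift j k) (lift i l)) => P; rewrite !mxE.
Qed.

(** By the chain rule, each further derivative tensors the representation with the standard one. The
    values remain polynomials composed with [linear_subst g] until they are evaluated at the origin,
    which the substitution fixes. *)
Lemma derivative_family (s : seq 'I_n) :
  exists (T : finType) (rho : 'M[C]_n -> T -> T -> C)
    (a : T -> {linear V -> {mpoly C[n]}}) (t0 : T),
  [/\ star_family rho,
      forall (g : GL C n) t P,
        a t (precomp g P) = \sum_u rho g u t *: (a u P \mPo linear_subst g)
    & forall P, a t0 P = dseq s P].
Proof.
elim: s => [|i s [T [rho [a [t0 [st cov E]]]]]].
  exists unit, (fun _ _ _ => 1), (fun=> (val : {linear V -> {mpoly C[n]}})), tt.
  split=> //; first exact: star_family_trivial.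
  by move=> g [] P; rewrite big_const card_unit /= scale1r addr0.
exists (T * 'I_n)%type, (fun g u t => rho g u.1 t.1 * g u.2 t.2),
  (fun t => (mderiv t.2 \o a t.1 : {linear V -> _})), (t0, i).
split=> [|g [t j] P|P] /=; last by rewrite E.
  exact: star_family_prod st (star_family_standard C n).
rewrite cov linear_sum /=; under eq_bigr do
  rewrite mderivZ mderiv_linear_subst scaler_sumr.
rewrite pair_bigA /=; apply: eq_bigr => u _.
by rewrite scalerA.
Qed.

Lemma covariant_derivative s : covariant (fun P => (dseq s P).@[fun=> 0]).
Proof.
have [T [rho [a [t0 [st cov E]]]]] := derivative_family s.
exists T, rho, (fun t P => (a t P).@[fun=> 0]), (fun t => (t == t0)%:R).
split=> // [t|g t P|P].
- have lin : linear (fun P => (a t P).@[fun=> 0] : C^o).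
    by move=> c P Q; rewrite linearP mevalD mevalZ.
  pose l : {scalar V} := HB.pack (fun P : V => (a t P).@[fun=> 0])
    (GRing.isLinear.Build _ _ _ _ _ lin).
  exact: (polynomial_function_scalar l).
- rewrite cov raddf_sum; apply: eq_bigr => u _ /=.
  by rewrite mevalZ comp_linear_subst0.
- rewrite (bigD1 t0) //= eqxx mul1r big1 ?addr0 ?E // => t /negbTE->.
  by rewrite mul0r.
Qed.

(** Enumerating the finite index type turns the family into matrices and column vectors, to which
    [occurs_lincomb] applies. *)
Lemma occurs_covariant F lambda : covariant F ->
  (forall b : GL C n, upper_triangular b -> forall P,
     F (precomp b P) = diag_character lambda b * F P) ->
  (exists g, F (precomp g (ESP C n r)) != 0) ->
  @occurs C n r lambda.
Proof.
move=> [T [rho [a [x [[one mul adj pol] pa cov E]]]]] F_eigen F0.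
pose e := @enum_val T predT.
have sumE (G : T -> C) : \sum_t G t = \sum_i G (e i).
  by rewrite (reindex e) //; apply/onW_bij/enum_val_bij.
pose rho' g : 'M[C]_#|T| := \matrix_(i, j) rho g (e i) (e j).
have st : star_representation rho'.
  split=> [|g h|g|i j].
  - by apply/matrixP => i j; rewrite !mxE one (inj_eq enum_val_inj).
  - apply/matrixP => i j; rewrite !mxE mul sumE.
    by apply: eq_bigr => k _; rewrite !mxE.
  - by apply/matrixP => i j; rewrite !mxE adj.
  - rewrite (_ : (fun _ => _) = fun g => rho g (e i) (e j)) //.
    by apply/funext => g; rewrite mxE.
have cov' (g : GL C n) i P :
    a (e i) (precomp g P) = \sum_j rho' g j i * a (e j) P.
  by rewrite cov sumE; apply: eq_bigr => j _; rewrite mxE.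
have FE P : F P = lincomb (fun i => a (e i)) (\col_i x (e i)) P.
  by rewrite E sumE; apply: eq_bigr => i _; rewrite mxE.
apply: (occurs_lincomb st _ cov' (x := \col_i x (e i))) => //.
  by move=> b hb P; rewrite -!FE F_eigen.
by have [g Fg] := F0; exists g; rewrite -FE.
Qed.

End Covariants.

(** * Two families of highest weight vectors *)

Section Characters.
Variables (C : numClosedFieldType) (n : nat) (b : 'M[C]_n).
Hypotheses (hb : upper_triangular b) (ub : b \in unitmx).
Implicit Types (lambda mu : 'rV[int]_n).

Lemma upper_triangular_det m (A : 'M[C]_m) :
  upper_triangular A -> \det A = \prod_i A i i.
Proof.
move=> hA; rewrite -det_tr det_trig; first by apply: eq_bigr => i _; rewrite mxE.
by apply/is_trig_mxP => i j ij; rewrite mxE hA.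
Qed.

Lemma upper_triangular_unit_diag i : b i i != 0.
Proof.
move: ub; rewrite unitmxE upper_triangular_det // unitfE.
by move/prodf_neq0/(_ i); apply.
Qed.

Lemma diag_characterD lambda mu :
  diag_character (lambda + mu) b = diag_character lambda b * diag_character mu b.
Proof.
rewrite -big_split; apply: eq_bigr => i _.
by rewrite mxE expfzDr // upper_triangular_unit_diag.
Qed.

Lemma diag_character0 : diag_character 0 b = 1.
Proof. by apply: big1 => i _; rewrite mxE. Qed.

Lemma diag_characterN lambda :
  diag_character (- lambda) b = (diag_character lambda b)^-1.
Proof.
have := diag_characterD lambda (- lambda).
by rewrite subrr diag_character0 => /esym/mulr1_eq/esym.
Qed.

Lemma diag_characterMn lambda m :
  diag_character (lambda *+ m) b = diag_character lambda b ^+ m.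
Proof.
elim: m => [|m IHm]; first by rewrite diag_character0.
by rewrite mulrS diag_characterD IHm exprS.
Qed.

Lemma diag_character_sum I (s : seq I) (Q : pred I) (l : I -> 'rV[int]_n) :
  diag_character (\sum_(i <- s | Q i) l i) b =
  \prod_(i <- s | Q i) diag_character (l i) b.
Proof. exact: (big_morph _ diag_characterD diag_character0). Qed.

Lemma diag_character_delta i : diag_character (delta_mx 0 i) b = b i i.
Proof.
rewrite /diag_character (bigD1 i) //= mxE !eqxx expr1z big1 ?mulr1 // => j ji.
by rewrite mxE (negbTE ji) andbF.
Qed.

End Characters.

Section HessianCovariants.
Variables (C : numClosedFieldType) (n r : nat) (o : 'I_n).
Hypothesis o0 : o = 0%N :> nat.
Local Notation V := (dhomog n C r).
Local Notation poly P := (mpoly_of_dhomog P).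
Implicit Types (P : V) (g : GL C n) (u v w : 'cV[C]_n).

(* Up to nonzero factors, the second and third derivatives of [P] at the first
   basis vector. *)
Definition quadratic_part P u v : C :=
  (dirderiv u (dirderiv v
    (iter (r - 2) (dirderiv (delta_mx o 0)) (poly P)))).@[fun=> 0].

Definition cubic_part P w : C :=
  (dirderiv w (dirderiv w (dirderiv w
    (iter (r - 3) (dirderiv (delta_mx o 0)) (poly P))))).@[fun=> 0].

Definition hessian P : 'M[C]_n :=
  \matrix_(i, j) quadratic_part P (delta_mx i 0) (delta_mx j 0).

Lemma meval_dirderiv v (p : {mpoly C[n]}) (x : 'I_n -> C) :
  (dirderiv v p).@[x] = \sum_i v i 0 * (dirderiv (delta_mx i 0) p).@[x].
Proof.
rewrite raddf_sum; apply: eq_bigr => i _.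
by rewrite /= mevalZ dirderiv_delta.
Qed.

Lemma dirderivC u v (p : {mpoly C[n]}) :
  dirderiv u (dirderiv v p) = dirderiv v (dirderiv u p).
Proof.
rewrite /dirderiv.
under eq_bigr => i _ do rewrite (linear_sum (mderiv i)) scaler_sumr.
under [RHS]eq_bigr => i _ do rewrite (linear_sum (mderiv i)) scaler_sumr.
rewrite exchange_big; apply: eq_bigr => i _; apply: eq_bigr => j _.
by rewrite !linearZ /= !scalerA mulrC mderiv_comm.
Qed.

Lemma quadratic_part_suml P u v :
  quadratic_part P u v = \sum_i u i 0 * quadratic_part P (delta_mx i 0) v.
Proof. exact: meval_dirderiv. Qed.

Lemma quadratic_partC P u v : quadratic_part P u v = quadratic_part P v u.
Proof. by rewrite /quadratic_part dirderivC. Qed.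

Lemma quadratic_partE P u v :
  quadratic_part P u v = (u^T *m hessian P *m v) 0 0.
Proof.
rewrite mxE quadratic_partC quadratic_part_suml; apply: eq_bigr => j _.
rewrite quadratic_partC quadratic_part_suml mxE mulrC; congr (_ * _).
by apply: eq_bigr => i _; rewrite !mxE.
Qed.

Lemma iter_dirderivZ c v p k :
  iter k (dirderiv (c *: v)) p = c ^+ k *: iter k (dirderiv v) p
    :> {mpoly C[n]}.
Proof.
elim: k => [|k IHk]; first by rewrite scale1r.
by rewrite !iterS IHk dirderivZl linearZ /= scalerA exprS.
Qed.

Lemma quadratic_part_precomp g P u v :
  quadratic_part (precomp g P) u v =
  (dirderiv (g *m u) (dirderiv (g *m v)
    (iter (r - 2) (dirderiv (g *m delta_mx o 0)) (poly P)))).@[fun=> 0].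
Proof.
by rewrite /quadratic_part iter_dirderiv_comp !dirderiv_comp comp_linear_subst0.
Qed.

Lemma cubic_part_precomp g P w :
  cubic_part (precomp g P) w =
  (dirderiv (g *m w) (dirderiv (g *m w) (dirderiv (g *m w)
    (iter (r - 3) (dirderiv (g *m delta_mx o 0)) (poly P))))).@[fun=> 0].
Proof.
by rewrite /cubic_part iter_dirderiv_comp !dirderiv_comp comp_linear_subst0.
Qed.

Lemma cubic_partZ P c w : cubic_part P (c *: w) = c ^+ 3 * cubic_part P w.
Proof.
rewrite /cubic_part !dirderivZl !linearZ /=.
by rewrite !exprS expr0 mulr1 !mulrA.
Qed.

Section Triangular.
Variable b : GL C n.
Hypothesis hb : upper_triangular b.

(** The Borel subgroup preserves the line of the first basis vector, so each derivative along it
    contributes one factor [b o o]. *)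
Lemma upper_triangular_delta0 : b *m delta_mx o 0 = b o o *: delta_mx o (0 : 'I_1).
Proof.
apply/colP => i; rewrite -colE !mxE eqxx andbT.
case: eqVneq => [->|io]; first by rewrite mulr1.
by rewrite mulr0 hb // o0 lt0n -o0 val_eqE.
Qed.

Lemma quadratic_part_triangular P u v :
  quadratic_part (precomp b P) u v =
  b o o ^+ (r - 2) * quadratic_part P (b *m u) (b *m v).
Proof.
rewrite quadratic_part_precomp upper_triangular_delta0 iter_dirderivZ.
by rewrite !linearZ.
Qed.

Lemma cubic_part_triangular P w :
  cubic_part (precomp b P) w = b o o ^+ (r - 3) * cubic_part P (b *m w).
Proof.
rewrite cubic_part_precomp upper_triangular_delta0 iter_dirderivZ.
by rewrite !linearZ.
Qed.

Lemma hessian_triangular P :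
  hessian (precomp b P) = b o o ^+ (r - 2) *: (b^T *m hessian P *m b).
Proof.
apply/matrixP => i j; rewrite !mxE quadratic_part_triangular quadratic_partE.
congr (_ * _); rewrite trmx_mul !mulmxA -[_ *m delta_mx j 0]mulmxA -!colE.
have -> : ((delta_mx i 0)^T : 'rV[C]_n) *m b^T = row i b^T.
  by rewrite trmx_delta -rowE.
rewrite mxE; apply: eq_bigr => k _.
rewrite !mxE; congr (_ * _); apply: eq_bigr => l _.
by rewrite !mxE.
Qed.

End Triangular.

Variables (k : nat) (hk : (k.+1 <= n)%N).
Local Notation emb := (widen_ord hk).

(** As a matrix product with this inclusion, the leading block gets its transformation rule from
    matrix algebra alone. *)
Definition leading_inclusion : 'M[C]_(n, k.+1) :=
  \matrix_(i, j) (i == emb j)%:R.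
Local Notation E := leading_inclusion.

Lemma mul_leading m (M : 'M[C]_(m, n)) i j : (M *m E) i j = M i (emb j).
Proof.
rewrite mxE (bigD1 (emb j)) //= mxE eqxx mulr1 big1 ?addr0 // => l lj.
by rewrite mxE (negbTE lj) mulr0.
Qed.

Lemma mul_leadingT m (M : 'M[C]_(n, m)) i j : (E^T *m M) i j = M (emb i) j.
Proof.
rewrite mxE (bigD1 (emb i)) //= !mxE eqxx mul1r big1 ?addr0 // => l lj.
by rewrite !mxE (negbTE lj) mul0r.
Qed.

Definition leading_block (M : 'M[C]_n) : 'M[C]_k.+1 := E^T *m M *m E.

Lemma leading_blockE M i j : leading_block M i j = M (emb i) (emb j).
Proof. by rewrite mul_leading mul_leadingT. Qed.

Lemma leading_delta j : E *m delta_mx j 0 = delta_mx (emb j) (0 : 'I_1).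
Proof. by apply/colP => i; rewrite -colE !mxE eqxx andbT. Qed.

Definition gram_det P : C := \det (leading_block (hessian P)).

(* In the span of the first [k+1] basis vectors, orthogonal to the first [k] of
   them for the quadratic part (last step of Gram-Schmidt, by Cramer's rule). *)
Definition ortho_vector P : 'cV[C]_n :=
  E *m (\adj (leading_block (hessian P)) *m delta_mx ord_max 0).

(* The factor [gram_det P] makes the function vanish where the Gram matrix is
   not invertible, so that its equivariance need only be checked elsewhere. *)
Definition cubic_covariant P : C := gram_det P * cubic_part P (ortho_vector P).

Lemma covariant_hessian i j : covariant (fun P => hessian P i j).
Proof.
apply: covariant_ext (covariant_derivative C r [:: i, j & nseq (r - 2) o]) => P.
rewrite mxE /quadratic_part !dirderiv_delta /=; congr (_ ^`M(_) ^`M(_)).@[_].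
by elim: (r - 2)%N => //= m ->; rewrite dirderiv_delta.
Qed.

Lemma covariant_leading i j :
  covariant (fun P => leading_block (hessian P) i j).
Proof.
by apply: covariant_ext (covariant_hessian (emb i) (emb j)) => P;
  rewrite leading_blockE.
Qed.

Lemma covariant_gram_det : covariant gram_det.
Proof. exact: covariant_det covariant_leading. Qed.

(** Expanding the cubic part in the coordinates of the orthogonal vector gives products of cofactors
    of the Gram matrix and derivatives at the origin. The directions are permuted so that the
    outermost one can be expanded each time. *)
Lemma covariant_cubic : covariant cubic_covariant.
Proof.
apply: covariantM; first exact: covariant_gram_det.
have covw i : covariant (fun P => ortho_vector P i 0).
  apply: covariant_mulmx => [l j|j l]; first exact: covariant_cst.
  apply: covariant_mulmx => [l' j'|j' l']; last exact: covariant_cst.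
  exact: covariant_adj covariant_leading _ _.
apply: (@covariant_ext _ _ _ (fun P => \sum_i ortho_vector P i 0 *
  (\sum_j ortho_vector P j 0 * (\sum_l ortho_vector P l 0 *
    (foldr (@mderiv n C) (poly P) [:: l, j, i & nseq (r - 3) o]).@[fun=> 0])))).
  move=> P; rewrite /cubic_part meval_dirderiv; apply: eq_bigr => i _.
  congr (_ * _); rewrite dirderivC meval_dirderiv; apply: eq_bigr => j _.
  congr (_ * _); rewrite [dirderiv (delta_mx i 0) _]dirderivC dirderivC.
  rewrite meval_dirderiv; apply: eq_bigr => l _.
  congr (_ * _); rewrite /= !dirderiv_delta.
  congr (_ ^`M(_) ^`M(_) ^`M(_)).@[_].
  by elim: (r - 3)%N => //= m ->; rewrite dirderiv_delta.
apply: covariant_sum => i; apply: covariantM => //.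
apply: covariant_sum => j; apply: covariantM => //.
apply: covariant_sum => l; apply: covariantM => //.
exact: covariant_derivative.
Qed.

(** Each of the [k.+1] rows of the Gram matrix carries [r - 2] derivatives along the first basis
    vector; the change of basis contributes the square of its determinant. *)
Definition gram_weight : 'rV[int]_n :=
  delta_mx 0 o *+ (k.+1 * (r - 2)) + (\sum_(i < n | (i < k.+1)%N) delta_mx 0 i) *+ 2.

(** One [gram_weight] comes from the prefactor and three from the orthogonal vector, which enters
    cubed; [r - 3] counts the derivatives along the first basis vector. The subtracted terms come
    from the cube of the factor by which [ortho_vector] is rescaled. *)
Definition cubic_weight : 'rV[int]_n :=
  gram_weight *+ 4 + delta_mx 0 o *+ (r - 3) - delta_mx 0 o *+ (3 * (r - 2))
    - delta_mx 0 (emb ord_max) *+ 3.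

Section Eigen.
Variable b : GL C n.
Hypothesis hb : upper_triangular b.
Local Notation bk := (leading_block b).
Local Notation c := (b o o ^+ (r - 2)).
Local Notation t := (b (emb ord_max) (emb ord_max)).

(** An upper triangular matrix preserves the span of the first [k.+1] basis vectors. *)
Lemma mul_leading_triangular : b *m E = E *m bk.
Proof.
apply/matrixP => i j; rewrite mul_leading mxE.
have [ik|ki] := ltnP i k.+1.
  have -> : i = emb (Ordinal ik) by apply: val_inj.
  rewrite (bigD1 (Ordinal ik)) //= mxE eqxx mul1r leading_blockE big1 ?addr0 //.
  move=> l; rewrite mxE eq_sym -!val_eqE /= => /negbTE->.
  by rewrite mul0r.
rewrite hb ?big1 // => [l _|]; last exact: leq_trans (ltn_ord j) ki.
rewrite mxE -val_eqE gtn_eqF ?mul0r //=.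
exact: leq_trans (ltn_ord l) ki.
Qed.

Lemma leading_upper_triangular : upper_triangular bk.
Proof. by move=> i j ji; rewrite leading_blockE hb. Qed.

Lemma leading_unit : bk \in unitmx.
Proof.
rewrite unitmxE (upper_triangular_det leading_upper_triangular) unitfE.
apply/prodf_neq0 => i _; rewrite leading_blockE.
by apply: upper_triangular_unit_diag hb _ _; exact: Defs.GL_unit.
Qed.

Lemma leading_hessian_triangular P :
  leading_block (hessian (precomp b P)) =
  c *: (bk^T *m leading_block (hessian P) *m bk).
Proof.
rewrite /leading_block hessian_triangular // -scalemxAr -scalemxAl; congr (_ *: _).
rewrite -/bk !mulmxA -[_ *m b *m E]mulmxA mul_leading_triangular !mulmxA.
by rewrite -trmx_mul mul_leading_triangular trmx_mul.
Qed.

Lemma gram_weightE :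
  diag_character gram_weight b = c ^+ k.+1 * \det bk ^+ 2.
Proof.
have ub := Defs.GL_unit b.
rewrite (diag_characterD hb ub) !(diag_characterMn hb ub) diag_character_delta.
rewrite -exprM mulnC; congr (_ * _ ^+ 2).
rewrite (diag_character_sum hb ub) (upper_triangular_det leading_upper_triangular).
rewrite (big_ord_narrow hk); apply: eq_bigr => i _.
by rewrite diag_character_delta leading_blockE.
Qed.

Lemma gram_det_triangular P :
  gram_det (precomp b P) = diag_character gram_weight b * gram_det P.
Proof.
rewrite /gram_det leading_hessian_triangular detZ !det_mulmx det_tr gram_weightE.
by ring.
Qed.

(** With an invertible Gram matrix [G], the coordinates [y] of the orthogonal vector are determined
    by [G *m y] being [gram_det P] times the last basis vector. That vector is an eigenvector of the
    lower triangular [bk^T], so the equation transforms by scalars only. *)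
Lemma ortho_vector_triangular P : gram_det P != 0 ->
  b *m ortho_vector (precomp b P) =
  (diag_character gram_weight b / (c * t)) *: ortho_vector P.
Proof.
move=> D0; have ub := Defs.GL_unit b.
have bn0 i : b i i != 0 := upper_triangular_unit_diag hb ub i.
set e : 'cV[C]_k.+1 := delta_mx ord_max 0.
set G := leading_block (hessian P).
set G' := leading_block (hessian (precomp b P)).
have c0 : c != 0 by rewrite expf_neq0.
have be : bk^T *m e = t *: e.
  apply/colP => i; rewrite /e -colE mxE [LHS]mxE leading_blockE 2!mxE eqxx andbT.
  case: eqVneq => [->|il]; first by rewrite mulr1.
  rewrite mulr0 hb //= ltn_neqAle -ltnS ltn_ord andbT.
  by apply: contra il => /eqP il; apply/eqP/val_inj.
have G'e : G' *m (\adj G' *m e) = gram_det (precomp b P) *: e.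
  by rewrite mulmxA mul_mx_adj mul_scalar_mx.
have Gy : G *m (bk *m (\adj G' *m e)) = (gram_det (precomp b P) / (c * t)) *: e.
  have ubT : bk^T \in unitmx by rewrite unitmx_tr leading_unit.
  apply: (can_inj (mulKmx ubT)).
  apply: (scalerI c0).
  have assoc (A1 A2 A3 : 'M_k.+1) (y : 'cV_k.+1) :
      c *: (A1 *m (A2 *m (A3 *m y))) = (c *: (A1 *m A2 *m A3)) *m y.
    by rewrite -scalemxAl !mulmxA.
  rewrite assoc -leading_hessian_triangular G'e -scalemxAr be !scalerA; congr (_ *: _).
  by field; rewrite c0 bn0.
rewrite /ortho_vector mulmxA mul_leading_triangular -mulmxA.
rewrite scalemxAr; congr (_ *m _).
apply: (scalerI D0).
rewrite -[in LHS]mul_scalar_mx -mul_adj_mx -mulmxA Gy -scalemxAr !scalerA.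
by rewrite gram_det_triangular; congr (_ *: _); ring.
Qed.

Lemma cubic_weightE :
  diag_character cubic_weight b =
  diag_character gram_weight b ^+ 4 * b o o ^+ (r - 3) / c ^+ 3 / t ^+ 3.
Proof.
have ub := Defs.GL_unit b; rewrite /cubic_weight; move: gram_weight => mu.
rewrite !(diag_characterD hb ub) !(diag_characterN hb ub).
by rewrite !(diag_characterMn hb ub) !diag_character_delta mulnC exprM.
Qed.

Lemma cubic_covariant_triangular P :
  cubic_covariant (precomp b P) =
  diag_character cubic_weight b * cubic_covariant P.
Proof.
rewrite /cubic_covariant gram_det_triangular.
have [D0|D0] := eqVneq (gram_det P) 0.
  rewrite D0; move: (cubic_part (precomp b P) _) (cubic_part P _) => x y.
  by move: (diag_character _ _) (diag_character _ _) => z1 z2; ring.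
have ub := Defs.GL_unit b.
have bn0 i : b i i != 0 := upper_triangular_unit_diag hb ub i.
have c0 : c != 0 by rewrite expf_neq0.
rewrite (cubic_part_triangular hb) (ortho_vector_triangular D0) cubic_partZ.
rewrite cubic_weightE; move: (b o o ^+ (r - 3)) (cubic_part P _) => d x.
move: (gram_det P) (diag_character _ _) => y z.
by field; rewrite c0 bn0.
Qed.

End Eigen.
End HessianCovariants.

(** * Nonvanishing on the orbit *)

Section ElementarySymmetricDerivatives.
Variables (C : numClosedFieldType) (n : nat).
Local Notation e m := (mesym n C m).
Implicit Types (u v : 'cV[C]_n).

Definition linear_form v : {mpoly C[n]} := \sum_i v i 0 *: 'X_i.
Local Notation dot u v := (\sum_i u i 0 * v i 0).
Local Notation one := (const_mx 1 : 'cV[C]_n).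

(** Since [e m] is squarefree, this operator keeps exactly the monomials that contain ['X_i]. *)
Lemma mulX_mderiv_mesym m i :
  'X_i * (e m)^`M(i) =
  \sum_(h : {set 'I_n} | (#|h| == m) && (i \in h)) 'X_[mesym1 h].
Proof.
rewrite mesymE linear_sum mulr_sumr big_mkcondr /=; apply: eq_bigr => h _.
rewrite mderivX mnmE; case: ifP => ih; last by rewrite scale0r mulr0.
rewrite scale1r -mpolyXD; congr 'X_[_]; apply/mnmP => j.
rewrite mnmDE mnmBE mnm1E !mnmE; case: eqVneq => [<-|_] /=.
  by rewrite ih.
by rewrite subn0.
Qed.

Lemma mderiv_mesymS m i :
  (e m.+1)^`M(i) =
  \sum_(h : {set 'I_n} | (#|h| == m) && (i \notin h)) 'X_[mesym1 h].
Proof.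
rewrite mesymE linear_sum /=.
transitivity (\sum_(h : {set 'I_n} | (#|h| == m.+1) && (i \in h))
  'X_[C, mesym1 (h :\ i)]).
  rewrite [RHS]big_mkcondr /=; apply: eq_bigr => h _.
  rewrite mderivX mnmE; case: ifP => ih; last by rewrite scale0r.
  rewrite scale1r; congr 'X_[_]; apply/mnmP => j.
  rewrite mnmBE mnm1E !mnmE in_setD1; case: eqVneq => [<-|_] /=.
    by rewrite ih.
  by rewrite subn0.
rewrite (reindex_onto (fun h => i |: h) (fun h => h :\ i)) /=; last first.
  by move=> h /andP[_ ih]; rewrite finset.setD1K.
apply: eq_big => h.
  rewrite finset.setU11 andbT finset.cardsU1; case: (boolP (i \in h)) => ih /=.
    rewrite andbF; apply/negbTE/negP => /andP[_ /eqP hE].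
    by move: ih; rewrite -hE !inE eqxx.
  by rewrite add1n eqSS andbT finset.setU1K // eqxx andbT.
by move=> /andP[_ /eqP->].
Qed.

(** The monomials of [e m] split into those avoiding ['X_i], which form the left side, and those
    containing it. *)
Lemma mderiv_mesym_rec m i : (e m.+1)^`M(i) = e m - 'X_i * (e m)^`M(i).
Proof.
rewrite mulX_mderiv_mesym mderiv_mesymS mesymE.
rewrite [X in _ = X - _](bigID (fun h : {set 'I_n} => i \in h)) /=.
by rewrite [RHS]addrC addKr.
Qed.

Lemma euler_mesym m : \sum_i 'X_i * (e m)^`M(i) = m%:R *: e m.
Proof.
under eq_bigr do rewrite mulX_mderiv_mesym big_mkcondr /=.
rewrite exchange_big mesymE scaler_sumr; apply: eq_bigr => h /eqP <-.
by rewrite -big_mkcond /= sumr_const scaler_nat.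
Qed.

Lemma dirderiv1_mesym m : (m <= n)%N -> dirderiv one (e m.+1) = (n - m)%:R *: e m.
Proof.
move=> mn; rewrite /dirderiv.
under eq_bigr do rewrite mxE scale1r mderiv_mesym_rec.
by rewrite sumrB euler_mesym sumr_const card_ord natrB // scalerBl !scaler_nat.
Qed.

(** Each derivative along the all-ones vector lowers the degree by one, with a factor that is
    nonzero while the degree is at most [n]. This reduces the forms at that point to [e 2] and
    [e 3]. *)
Lemma iter_dirderiv1_mesym m j : (m + j <= n)%N ->
  exists2 c, c != 0 & iter j (dirderiv one) (e (m + j)) = c *: e m.
Proof.
elim: j => [|j IHj] mjn; first by exists 1; rewrite ?oner_eq0 ?addn0 ?scale1r.
rewrite addnS in mjn *; have [c c0 cE] := IHj (ltnW mjn).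
exists ((n - (m + j))%:R * c).
  by rewrite mulf_neq0 // pnatr_eq0 subn_eq0 -ltnNge.
rewrite iterSr dirderiv1_mesym ?(ltnW mjn) //.
have iterZ x (p : {mpoly C[n]}) :
    iter j (dirderiv one) (x *: p) = x *: iter j (dirderiv one) p.
  by elim: j {IHj mjn cE} => //= j ->; rewrite linearZ.
by rewrite iterZ cE scalerA.
Qed.

Lemma dirderiv_linear_form u v : dirderiv u (linear_form v) = (dot u v)%:MP.
Proof.
rewrite /dirderiv rmorph_sum; apply: eq_bigr => i _ /=.
rewrite (linear_sum (mderiv i)) (bigD1 i) //= big1 => [|j ji].
  rewrite addr0 mderivZ mderivX mnm1E eqxx scale1r.
  have -> : (U_(i) - U_(i) = 0 :> 'X_{1..n})%MM.
    by apply/mnmP => l; rewrite mnmBE subnn mnm0E.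
  by rewrite mpolyX0 scalerA -mul_mpolyC mulr1.
by rewrite mderivZ mderivX mnm1E (negbTE ji) scale0r scaler0.
Qed.

Lemma mesym1_linear_form : e 1 = linear_form one.
Proof. by rewrite mesym1E; apply: eq_bigr => i _; rewrite mxE scale1r. Qed.

Lemma mderiv_mesym1 i : (e 1)^`M(i) = 1.
Proof. by rewrite mderiv_mesym_rec mesym0E -mpolyC1 mderivC mulr0 subr0. Qed.

Lemma mderiv_mesym2 i : (e 2)^`M(i) = e 1 - 'X_i.
Proof. by rewrite mderiv_mesym_rec mderiv_mesym1 mulr1. Qed.

Lemma dirderiv_mesym2 v : dirderiv v (e 2) = dot v one *: e 1 - linear_form v.
Proof.
rewrite scaler_suml -sumrB; apply: eq_bigr => i _.
by rewrite mderiv_mesym2 scalerBr mxE mulr1.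
Qed.

Lemma dirderiv2_mesym2 u v :
  dirderiv u (dirderiv v (e 2)) = (dot v one * dot u one - dot u v)%:MP.
Proof.
rewrite dirderiv_mesym2 linearB linearZ /= mesym1_linear_form.
by rewrite !dirderiv_linear_form -mul_mpolyC -mpolyCM -mpolyCB.
Qed.

(** On the hyperplane of coordinate sum 0, Newton's identity makes [e 3] one third of the sum of
    cubes, and the third derivative of a cubic form along [v] is 6 times its value at [v]. *)
Lemma dirderiv3_mesym3 v : dot v one = 0 ->
  dirderiv v (dirderiv v (dirderiv v (e 3))) = (2 * \sum_i v i 0 ^+ 3)%:MP.
Proof.
move=> v0; pose v2 : 'cV[C]_n := \col_i v i 0 ^+ 2.
have D1 : dirderiv v (e 3) =
    \sum_i v i 0 *: ('X_i * 'X_i) - linear_form v * e 1.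
  (* The term with [e 2] is zero, but with it the identity holds summand by summand. *)
  transitivity (dot v one *: e 2 + \sum_i v i 0 *: ('X_i * 'X_i)
    - linear_form v * e 1); last by rewrite v0 scale0r add0r.
  rewrite scaler_suml mulr_suml -big_split -sumrB; apply: eq_bigr => i _ /=.
  rewrite mderiv_mesym_rec mderiv_mesym2 mxE mulr1 mulrBr opprB.
  by rewrite scalerDr scalerBr -scalerAl addrA.
have De1 : dirderiv v (e 1) = 0.
  by rewrite mesym1_linear_form dirderiv_linear_form v0 mpolyC0.
have D2 : dirderiv v (dirderiv v (e 3)) = 2 *: linear_form v2 - dot v v *: e 1.
  rewrite D1 linearB /= dirderivM De1 mulr0 addr0 dirderiv_linear_form.
  rewrite mul_mpolyC; congr (_ - _).
  rewrite (linear_sum (dirderiv v)) scaler_sumr; apply: eq_bigr => i _ /=.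
  rewrite linearZ /= dirderivM.
  have -> : dirderiv v 'X_i = (v i 0)%:MP.
    have -> : 'X_i = linear_form (delta_mx i 0).
      rewrite /linear_form (bigD1 i) //= mxE !eqxx scale1r big1 ?addr0 // => j ji.
      by rewrite mxE (negbTE ji) scale0r.
    rewrite dirderiv_linear_form (bigD1 i) //= mxE !eqxx mulr1 big1 ?addr0 //.
    by move=> j ji; rewrite mxE (negbTE ji) mulr0.
  rewrite [_ * (v i 0)%:MP]mulrC -mulr2n mul_mpolyC -scaler_nat !scalerA mxE.
  by congr (_ *: _); ring.
rewrite D2 linearB !linearZ /= De1 oppr0 scaler0 addr0 dirderiv_linear_form.
rewrite -mul_mpolyC -mpolyCM; congr (_ * _)%:MP.
by apply: eq_bigr => i _; rewrite mxE -exprS.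
Qed.

End ElementarySymmetricDerivatives.

Section OrthogonalFrames.
Variables (C : numClosedFieldType) (n r : nat) (o : 'I_n).
Hypotheses (o0 : o = 0%N :> nat) (hr : (2 < r)%N) (hrn : (r < n)%N).
Variable g : GL C n.
Hypothesis g_one : forall l, g l o = 1.
Hypothesis g_ortho : forall i j, i != j -> \sum_l g l i * g l j = 0.
Hypothesis g_norm : forall i, \sum_l g l i ^+ 2 != 0.
Local Notation P := (precomp g (ESP C n r)).
Local Notation one := (const_mx 1 : 'cV[C]_n).

Lemma frame_sum i : i != o -> \sum_l g l i = 0.
Proof.
by move=> io; rewrite -[RHS](g_ortho io); apply: eq_bigr => l _; rewrite g_one mulr1.
Qed.

Lemma frame_first : g *m delta_mx o (0 : 'I_1) = one.
Proof. by apply/colP => l; rewrite -colE !mxE g_one. Qed.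

(** The frame sends the first basis vector to the all-ones vector, where the form is a multiple of
    the polarization of [e 2]. Orthogonality makes it diagonal: up to this factor the first entry is
    [n * n - n], and the others are minus the squared norms. *)
Lemma frame_hessian :
  exists2 d : 'rV[C]_n, (forall i, d 0 i != 0) & hessian o P = diag_mx d.
Proof.
have rE : (2 + (r - 2))%N = r by rewrite subnKC // ltnW.
have [] := @iter_dirderiv1_mesym C n 2 (r - 2); first by rewrite rE ltnW.
move=> c c0; rewrite rE => cE.
pose d : 'rV[C]_n := \row_i
  (c * ((\sum_l g l i) * (\sum_l g l i) - \sum_l g l i ^+ 2)).
have hE i j : hessian o P i j =
    c * ((\sum_l g l j) * (\sum_l g l i) - \sum_l g l i * g l j).
  rewrite mxE quadratic_part_precomp frame_first [iter _ _ _]cE !linearZ /=.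
  rewrite dirderiv2_mesym2 mevalC; congr (_ * (_ * _ - _));
    by apply: eq_bigr => l _; rewrite -!colE !mxE ?mulr1.
exists d => [i|]; last first.
  apply/matrixP => i j; rewrite hE !mxE; case: eqVneq => [->|ij].
    by rewrite mulr1n; congr (_ * (_ - _)); apply: eq_bigr => l _; rewrite expr2.
  rewrite mulr0n g_ortho // subr0.
  have [io|io] := eqVneq i o; last by rewrite (frame_sum io) !mulr0.
  by rewrite (@frame_sum j) ?mul0r ?mulr0 // -io eq_sym.
rewrite mxE mulf_neq0 //; have [->|io] := eqVneq i o; last first.
  by rewrite frame_sum // mul0r sub0r oppr_eq0.
under eq_bigr do rewrite g_one.
under [X in _ - X]eq_bigr do rewrite g_one expr1n.
rewrite sumr_const card_ord -natrM -natrB ?pnatr_eq0; nia.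
Qed.

Lemma frame_cubic i : i != o -> \sum_l g l i ^+ 3 != 0 ->
  cubic_part o P (delta_mx i 0) != 0.
Proof.
move=> io gi.
have rE : (3 + (r - 3))%N = r by rewrite subnKC.
have [] := @iter_dirderiv1_mesym C n 3 (r - 3); first by rewrite rE ltnW.
move=> c c0; rewrite rE => cE.
rewrite cubic_part_precomp frame_first [iter _ _ _]cE !linearZ /=.
rewrite dirderiv3_mesym3; last first.
  rewrite -[RHS](frame_sum io); apply: eq_bigr => l _.
  by rewrite -colE !mxE mulr1.
rewrite mevalC !mulf_neq0 ?pnatr_eq0 //.
by under eq_bigr do rewrite -colE mxE.
Qed.

Variables (k : nat) (hk : (k.+1 <= n)%N).
Local Notation last := (widen_ord hk ord_max).

Lemma frame_gram_det : gram_det o hk P != 0.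
Proof.
have [d d0 hE] := frame_hessian.
rewrite /gram_det hE upper_triangular_det => [|i j ji].
  by apply/prodf_neq0 => i _; rewrite leading_blockE mxE eqxx mulr1n.
by rewrite leading_blockE mxE -val_eqE gtn_eqF.
Qed.

(** The Hessian being diagonal, the Gram-Schmidt vector is a nonzero multiple of the last basis
    vector, which leaves the sum of cubes of one column. *)
Lemma frame_cubic_covariant : last != o -> \sum_l g l last ^+ 3 != 0 ->
  cubic_covariant o hk P != 0.
Proof.
move=> lo glast; have D0 := frame_gram_det.
apply: mulf_neq0 (D0) _.
have [d d0 hE] := frame_hessian.
set G := leading_block hk (hessian o P).
pose e : 'cV[C]_k.+1 := delta_mx ord_max 0.
have Ge : G *m e = d 0 last *: e.
  apply/colP => i; rewrite -colE mxE leading_blockE hE [LHS]mxE [RHS]mxE.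
  rewrite [e _ _]mxE eqxx andbT -!val_eqE /=.
  case: eqP => [ik|_]; last by rewrite mulr0.
  by rewrite mulr1; congr (d 0 _); apply: val_inj.
have wE : ortho_vector o hk P = (gram_det o hk P / d 0 last) *: delta_mx last 0.
  rewrite /ortho_vector -leading_delta scalemxAr; congr (_ *m _).
  apply: (scalerI (d0 last)); rewrite scalemxAr -/e -Ge mulmxA mul_adj_mx.
  by rewrite mul_scalar_mx scalerA mulrC divfK.
rewrite wE cubic_partZ mulf_neq0 ?frame_cubic //.
by rewrite expf_neq0 // mulf_neq0 ?invr_eq0.
Qed.

End OrthogonalFrames.

(** * The weight lattice *)

Section HelmertFrame.
Variables (C : numClosedFieldType) (n : nat) (o : 'I_n).
Hypothesis o0 : o = 0%N :> nat.

(* The columns of the Helmert matrix. *)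
Definition helmert (j l : nat) : C :=
  if j == 0%N then 1 else if (l < j)%N then 1 else
  if l == j then - j%:R else 0.

Lemma sum_step (j : 'I_n) (x y : C) :
  \sum_(l < n) (if (l < j)%N then x else if l == j :> nat then y else 0) =
  j%:R * x + y.
Proof.
transitivity (\sum_(l < n)
    ((if (l < j)%N then x else 0) + (if l == j then y else 0))).
  apply: eq_bigr => l _; rewrite -val_eqE /=.
  by case: ltngtP => _; rewrite ?addr0 ?add0r.
rewrite big_split /= -!big_mkcond /= big_pred1_eq.
by rewrite (big_ord_narrow (ltnW (ltn_ord j))) sumr_const card_ord mulr_natl.
Qed.

Lemma sum_helmert_exp (j : 'I_n) m : (j != 0 :> nat)%N ->
  \sum_(l < n) helmert j l ^+ m.+1 = j%:R + (- j%:R) ^+ m.+1.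
Proof.
move=> /negbTE j0; rewrite -[X in X + _](mulr1 j%:R) -sum_step.
apply: eq_bigr => l _; rewrite /helmert j0; case: ifP => _.
  by rewrite expr1n.
by case: ifP => _ //; rewrite expr0n.
Qed.

(** For [0 < i < j], column [j] is 1 on the support of column [i], so the product is the sum of
    column [i]; for [i = 0] it is the sum of column [j]. Both sums are 0. *)
Lemma helmert_ortho (i j : 'I_n) : i != j ->
  \sum_(l < n) helmert i l * helmert j l = 0.
Proof.
wlog ij : i j / (i < j)%N => [hw|_].
  have [lt|lt|/val_inj->] := ltngtP i j; last by rewrite eqxx.
    exact: hw.
  by rewrite eq_sym => ji; under eq_bigr do rewrite mulrC; apply: hw.
have j0 : (j == 0 :> nat)%N = false by rewrite gtn_eqF // (leq_ltn_trans _ ij).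
have [i0|i0] := eqVneq (i : nat) 0%N.
  transitivity (\sum_(l < n) helmert j l ^+ 1).
    by apply: eq_bigr => l _; rewrite {1}/helmert i0 mul1r.
  by rewrite sum_helmert_exp ?j0 // expr1 subrr.
transitivity (\sum_(l < n) helmert i l ^+ 1).
  apply: eq_bigr => l _; rewrite expr1 /helmert (negbTE i0) j0.
  case: ifP => li; first by rewrite (ltn_trans li ij) mulr1.
  by case: eqP => [->|_]; rewrite ?mul0r // ij mulr1.
by rewrite sum_helmert_exp // expr1 subrr.
Qed.

(** The sum of cubes of the Helmert column [j] is [j - j ^ 3], which is 0 for [j = 1]. Column 2,
    with sum -6, is therefore moved to position [i], and column 0 stays in place. *)
Lemma exists_frame (i : 'I_n) : (2 < n)%N -> i != o ->
  exists g : GL C n,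
  [/\ forall l, g l o = 1,
      forall j k, j != k -> \sum_l g l j * g l k = 0,
      forall j, \sum_l g l j ^+ 2 != 0
    & \sum_l g l i ^+ 3 != 0].
Proof.
move=> n2 io.
pose i2 : 'I_n := Ordinal n2.
have i2o : i2 != o by rewrite -val_eqE /= o0.
pose s := tperm i i2.
have so : s o = o by rewrite tpermD.
pose g : 'M[C]_n := \matrix_(l, j) helmert (s j) l.
have gE l j : g l j = helmert (s j) l by rewrite mxE.
have g_ortho j k : j != k -> \sum_l g l j * g l k = 0.
  move=> jk; under eq_bigr do rewrite !gE.
  by rewrite helmert_ortho // (inj_eq perm_inj).
have g_norm j : \sum_l g l j ^+ 2 != 0.
  under eq_bigr do rewrite gE.
  have [sj0|sj0] := eqVneq (s j : nat) 0%N.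
    under eq_bigr do rewrite sj0 expr1n.
    by rewrite sumr_const card_ord pnatr_eq0; lia.
  rewrite sum_helmert_exp // sqrrN -natrX -natrD pnatr_eq0; lia.
have gu : g \in unitmx.
  have : g^T *m g = diag_mx (\row_j \sum_l g l j ^+ 2).
    apply/matrixP => j k; rewrite !mxE; case: eqVneq => [->|jk].
      by rewrite mulr1n; apply: eq_bigr => l _; rewrite mxE expr2.
    by rewrite mulr0n -[RHS](g_ortho _ _ jk); apply: eq_bigr => l _; rewrite mxE.
  move=> /(congr1 determinant); rewrite det_mulmx det_tr det_diag => dE.
  rewrite unitmxE unitfE; apply/eqP => g0.
  move: dE; rewrite g0 mul0r => /esym/eqP; rewrite prodf_seq_eq0 => /hasP[j _].
  by rewrite /= mxE (negbTE (g_norm j)).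
exists (MkGL gu); split=> //= [l|].
  by rewrite gE so /helmert o0.
under eq_bigr do rewrite gE tpermL.
rewrite sum_helmert_exp //=.
have -> : 2%:R + (- 2%:R) ^+ 3 = - 6%:R :> C by ring.
by rewrite oppr_eq0 pnatr_eq0.
Qed.

End HelmertFrame.

Section WeightsOccur.
Variables (C : numClosedFieldType) (n r : nat) (o : 'I_n).
Hypotheses (o0 : o = 0%N :> nat) (hr : (2 < r)%N) (hrn : (r < n)%N).
Let n2 : (2 < n)%N := ltn_trans hr hrn.

Lemma delta_row_entry (j i : 'I_n) : (delta_mx 0 j : 'rV[int]_n) 0 i = (i == j)%:R.
Proof. by rewrite mxE eqxx. Qed.

Lemma gram_weight_entry k (hk : (k.+1 <= n)%N) i :
  gram_weight r o k 0 i =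
  (i == o)%:R *+ (k.+1 * (r - 2)) + (i <= k)%N%:R *+ 2.
Proof.
rewrite mxE !mulmxnE delta_row_entry summxE; congr (_ *+ _ + _ *+ _).
under eq_bigr do rewrite delta_row_entry.
rewrite big_mkcond (bigD1 i) //= eqxx big1 ?addr0 => [|j ji].
  by rewrite ltnS; case: ifP.
by rewrite eq_sym (negbTE ji) if_same.
Qed.

Lemma gram_weight_occurs k (hk : (k.+1 <= n)%N) :
  ESP_weights C n r (gram_weight r o k).
Proof.
split.
  move=> i j ij; rewrite !gram_weight_entry // -!val_eqE /= o0.
  move: (_ * _)%N => m; case: i j ij => [i /= _] [j /= _]; case: i => [|i] ij;
    rewrite ?mulr0n ?mul0rn; lia.
apply: (occurs_covariant (covariant_gram_det C r o hk)) => [b hb P|].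
  exact: gram_det_triangular.
have [|g [g1 gort gnorm _]] := @exists_frame C n o o0 (Ordinal n2) n2.
  by rewrite -val_eqE /= o0.
by exists g; apply: frame_gram_det.
Qed.

Lemma cubic_weight_occurs k (hk : (k.+1 <= n)%N) : (0 < k)%N ->
  ESP_weights C n r (cubic_weight r o hk).
Proof.
move=> k0; split.
  have entry i : cubic_weight r o hk 0 i = gram_weight r o k 0 i *+ 4 +
      ((i == o)%:R *+ (r - 3) - (i == o)%:R *+ (3 * (r - 2))
        - (i == widen_ord hk ord_max)%:R *+ 3).
    rewrite /cubic_weight; move: (gram_weight r o k) => mu.
    by rewrite !mxE !mulmxnE !delta_row_entry !eqxx /=; ring.
  (* This bound makes the first entry the largest. The later entries are 8 before position [k], then
     5 at [k], then 0. *)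
  have : (2 * (r - 2) <= k.+1 * (r - 2))%N by rewrite leq_mul2r ltnS k0 orbT.
  move=> m2 i j ij; rewrite !entry !gram_weight_entry // -!val_eqE /= o0.
  move: (k.+1 * (r - 2))%N m2 => m m2; case: i j ij => [i /= _] [j /= _].
  case: i => [|i] ij; last first.
    have -> : (j == 0)%N = false by lia.
    rewrite !mul0rn /=; have [lt|gt|<-] := ltngtP i.+1 k; lia.
  case: j ij => [|j] _; first by rewrite lexx.
  have mulrn_int (x : int) p : x *+ p = x * p%:Z by rewrite -mulr_natr natz.
  by rewrite !mulrn_int /= !mul1r !mul0r; lia.
apply: (occurs_covariant (covariant_cubic C r o hk)) => [b hb P|].
  exact: cubic_covariant_triangular.
have lo : widen_ord hk ord_max != o by rewrite -val_eqE /= o0 -lt0n.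
have [g [g1 gort gnorm gcub]] := exists_frame C o0 n2 lo.
by exists g; apply: frame_cubic_covariant.
Qed.

(** * Generating the lattice *)

Section Lattice.
Variable H : set 'rV[int]_n.
Hypotheses (Hsub : subgroup_closed H) (HS : ESP_weights C n r `<=` H).

Let H0 : H 0. Proof. by have [] := Hsub. Qed.
Let HB x y : H x -> H y -> H (x - y). Proof. by have [_] := Hsub; apply. Qed.
Let HN x : H x -> H (- x). Proof. by move=> hx; rewrite -sub0r; apply: HB. Qed.
Let HD x y : H x -> H y -> H (x + y).
Proof. by move=> hx hy; rewrite -[y]opprK; apply/HB/HN. Qed.
Let HMn x m : H x -> H (x *+ m).
Proof. by move=> hx; elim: m => // m IHm; rewrite mulrS; apply: HD. Qed.
Let HZ x (c : int) : H x -> H (c *: x).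
Proof.
move=> hx; case: c => m; first by rewrite -natz scaler_nat; apply: HMn.
by rewrite NegzE scaleNr -natz scaler_nat; apply/HN/HMn.
Qed.

Local Notation e i := (delta_mx 0 i : 'rV[int]_n).

(** The Gram determinant of order 1 has weight [r - 2] plus 2 times the first basis vector. *)
Lemma lattice_first : H (e o *+ r).
Proof.
have n0 : (1 <= n)%N by rewrite ltnW // ltnW.
have := HS (gram_weight_occurs n0).
rewrite /gram_weight mul1n (big_pred1 o) => [|i]; last first.
  by rewrite /= ltnS leqn0 -val_eqE /= o0.
by rewrite -mulrnDr subnK // ltnW.
Qed.

(** Consecutive Gram weights differ by [e o *+ (r - 2) + e i *+ 2], and the cubic weight yields
    [e o *+ (2 * r - 3) + e i *+ 3]. Their difference is [e o *+ (r - 1) + e i], from which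
    [e o *+ r] is subtracted. *)
Lemma lattice_root i : H (e i - e o).
Proof.
have [->|io] := eqVneq i o; first by rewrite subrr.
have i0 : (0 < i)%N by rewrite lt0n -o0 val_eqE.
(* Since [i] is positive, [i.-1.+1] is [i]: this form exposes the last index of a block of size
   [i + 1]. *)
have hi : (i.-1.+2 <= n)%N by rewrite prednK.
have hi' : (i.-1.+1 <= n)%N by rewrite ltnW.
have iE : widen_ord hi ord_max = i by apply: val_inj; rewrite /= prednK.
have hA : H (e o *+ (r - 2) + e i *+ 2).
  have -> : e o *+ (r - 2) + e i *+ 2 =
      gram_weight r o i.-1.+1 - gram_weight r o i.-1.
    rewrite /gram_weight (bigD1 i) /=; last by rewrite prednK.
    rewrite (eq_bigl (fun j : 'I_n => (j < i.-1.+1)%N)); last first.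
      by move=> j; rewrite -val_eqE /=; lia.
    rewrite mulSn mulrnDr; set x := \sum_(_ < _ | _) _.
    move: x (e o *+ (r - 2)) (e o *+ (i.-1.+1 * _)) (e i) => x u v w.
    by apply/rowP => j; rewrite !mxE; ring.
  by apply: HB; apply/HS/gram_weight_occurs.
have hB : H (e o *+ (3 * (r - 2)) - e o *+ (r - 3) + e i *+ 3).
  have -> : e o *+ (3 * (r - 2)) - e o *+ (r - 3) + e i *+ 3 =
      gram_weight r o i.-1.+1 *+ 4 - cubic_weight r o hi.
    rewrite /cubic_weight iE; move: (gram_weight _ _ _) => mu.
    move: (e o *+ (r - 3)) (e o *+ _) (e i) => u v w.
    by apply/rowP => j; rewrite !mxE; ring.
  apply: HB; first by apply/HMn/HS/gram_weight_occurs.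
  exact/HS/cubic_weight_occurs.
have -> : e i - e o = e o *+ (3 * (r - 2)) - e o *+ (r - 3) + e i *+ 3 -
    (e o *+ (r - 2) + e i *+ 2) - e o *+ r.
  have [s ->] : exists s, r = s.+3 by exists (r - 3)%N; lia.
  rewrite !subSS !subn0; move: (e o) (e i) => u v.
  by apply/rowP => j; rewrite !mxE !mulmxnE; ring.
by apply: HB lattice_first; apply: HB.
Qed.

Lemma lattice_full (lambda : 'rV[int]_n) :
  (r %| \sum_i lambda 0 i)%Z -> H lambda.
Proof.
move=> /dvdzP[q qE].
have -> : lambda = \sum_i lambda 0 i *: (e i - e o) + q *: (e o *+ r).
  under eq_bigr do rewrite scalerBr.
  rewrite sumrB -row_sum_delta -scaler_suml qE -scaler_nat scalerA natz.
  by rewrite subrK.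
apply: HD; last by apply/HZ/lattice_first.
by apply: (big_ind H) => // i _; apply/HZ/lattice_root.
Qed.

End Lattice.

(** * Degrees of the occurring weights *)

(** The polynomial ['X^m - 1] splits and is separable in characteristic 0, and among [m] distinct
    [m]-th roots of unity one is primitive. *)
Lemma primitive_root_exists m : (0 < m)%N -> exists z : C, m.-primitive_root z.
Proof.
pose p : {poly C} := 'X^m - 1; have [s Dp] := closed_field_poly_normal p.
move=> m0; rewrite (monicP _) ?monicXnsubC // scale1r in Dp.
have sm1 : all m.-unity_root s by apply/allP=> z; rewrite -root_prod_XsubC -Dp.
have sz_s : (m < (size s).+1)%N.
  by rewrite -(size_prod_XsubC s id) -Dp size_XnsubC.
have [|z] := hasP (has_prim_root m0 sm1 _ sz_s); last by exists z.
by rewrite -separable_prod_XsubC -Dp separable_Xn_sub_1 // pnatr_eq0 -lt0n.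
Qed.

Lemma precomp_scalar (g : GL C n) z (P : dhomog n C r) :
  g = z%:M :> 'M_n -> z ^+ r = 1 -> precomp g P = P.
Proof.
move=> gE zr; apply: val_inj => /=.
rewrite comp_mpolyE [RHS]mpolyE; apply: eq_big_seq => m mP.
congr (_ *: _); rewrite [RHS]mpolyXE_id.
transitivity (\prod_i (z ^+ m i *: 'X_i ^+ m i : {mpoly C[n]})).
  apply: eq_bigr => i _; rewrite tnth_mktuple gE -exprZn; congr (_ ^+ _).
  rewrite (bigD1 i) //= big1 ?addr0 => [|j ji].
    by rewrite mxE eqxx mulr1n.
  by rewrite mxE eq_sym (negbTE ji) mulr0n scale0r.
rewrite scaler_prod -expr_sum.
have -> : (\sum_i m i = r)%N.
  by rewrite -mdegE; exact: (dhomog_mf (dhomog_is_dhomog P) mP).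
by rewrite zr scale1r.
Qed.

(** A primitive [r]-th root of unity [z], as a scalar matrix, fixes every form of degree [r], yet
    multiplies a highest weight vector by [z] to the sum of the entries of [lambda]. *)
Lemma occurs_degree lambda : @occurs C n r lambda -> (r %| \sum_i lambda 0 i)%Z.
Proof.
move=> [V [rho [phi [[_ _ [v [v0 _ vt]]] phi_inj phi_act]]]].
have r0 : (0 < r)%N by apply: ltn_trans hr.
have [z zr] := primitive_root_exists r0.
have z0 : z != 0.
  apply: contra_eq_neq (prim_expr_order zr) => ->.
  by rewrite expr0n gtn_eqF // eq_sym oner_eq0.
have gu : (z%:M : 'M[C]_n) \in unitmx.
  by rewrite unitmxE det_scalar unitfE expf_neq0.
pose g := MkGL gu.
have gd : g = diag_mx (const_mx z) :> 'M_n by rewrite /= diag_const_mx.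
have [P fP] : exists P, phi v P != 0.
  apply/not_existsP => f0; move/eqP: v0; apply; apply: phi_inj.
  rewrite linear0; apply: val_inj; apply/funext => P /=.
  by apply/eqP/negPn/negP; exact: f0.
have E : phi v P = z ^ (\sum_i lambda 0 i) * phi v P.
  have /(congr1 (fun f => f P)) := congr1 (@regular_fun _ _ _) (phi_act g v).
  rewrite (vt g _ gd) linearZ /= => /esym E.
  have PP : orbit_closure_precomp g P = P.
    apply: val_inj; apply: (precomp_scalar (z := z)) => //.
    exact: prim_expr_order zr.
  rewrite PP in E; rewrite {1}E; congr (_ * _).
  under eq_bigr do rewrite mxE.
  by rewrite (big_morph (fun m : int => z ^ m) (fun m p => expfzDr m p z0) (expr0z z)).
have {E} : z ^ (\sum_i lambda 0 i) = 1.
  by apply: (mulIf fP); rewrite mul1r -E.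
rewrite dvdzE; case: (\sum_i _) => m zm /=; rewrite (prim_order_dvd zr).
  by apply/eqP.
by apply/eqP/invr_inj; rewrite invr1.
Qed.

End WeightsOccur.

Theorem theorem7 (R : realType) (n r : nat) (hr : (2 < r)%N) (hrn : (r < n)%N) :
  generated_subgroup (ESP_weights R[i] n r) =
  [set lambda : 'rV[int]_n | (r %| \sum_(i < n) lambda ord0 i)%Z].
Proof.
have n0 : (0 < n)%N by apply: leq_trans hrn.
apply/seteqP; split; last first.
  (* The generated subgroup is an intersection, so membership is checked in every subgroup [H]
     containing the weights. *)
  move=> lambda /= hl H [Hsub HS].
  by apply: (lattice_full (C := R[i]) (r := r) (o := Ordinal n0)).
apply: smallest_sub => [|lambda [_ hl]]; last exact: occurs_degree hl.
split=> [|x y /= hx hy]; first by rewrite /= big1 // => i _; rewrite mxE.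
under eq_bigr do rewrite !mxE.
by rewrite sumrB rpredB.
Qed.
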